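(* Let $p,q$ be nonnegative integers, let $\kappa_1,\dots,\kappa_p,\mu_1,\dots,\mu_q$ be complex numbers none of which is in $\{0,-1,-2,\dots\}$, let $\alpha,\beta\in\mathbb{C}$ with $\Re(\alpha)>0$, and let $x,y,s\in\mathbb{C}$ with $\Re(x)>0$, $\Re(y)>0$, $\Re(s)>0$, $\Re(x+s)>0$, $\Re(y+s)>0$. Then the Mellin transform in $\rho$ of the M-beta function is $$\int_0^\infty \rho^{s-1}\,{}^{M}B_{p,q}^{(\alpha,\beta)}(x,y;\rho)\,d\rho = B(x+s,y+s)\;{}^{M}\Gamma_{p,q}^{(\alpha,\beta)}(s;0),$$ where both the M-beta function and the M-gamma function are taken with parameters $\kappa_1,\dots,\kappa_p;\mu_1,\dots,\mu_q$.
   Context: $(\lambda)_m=\Gamma(\lambda+m)/\Gamma(\lambda)$, $(\lambda)_0=1$ is the Pochhammer symbol and $B(x,y)=\int_0^1 t^{x-1}(1-t)^{y-1}dt$ is the classical beta function. The generalized M-series is $${}_{p}^{\alpha}M^{\beta}_{q}(\kappa_{1},\ldots,\kappa_{p};\mu_{1},\ldots,\mu_{q};z)=\sum_{m=0}^{\infty}\frac{(\kappa_{1})_{m}\cdots(\kappa_p)_{m}}{(\mu_1)_{m}\cdots(\mu_q)_{m}}\frac{z^{m}}{\Gamma(\alpha m+\beta)}.$$ The modified gamma (M-gamma) function is $${}^{M}\Gamma_{p,q}^{(\alpha,\beta)}(x;\rho)={}^{M}\Gamma_{p,q}^{(\alpha,\beta)}(\kappa_{1},\ldots,\kappa_p;\mu_1,\ldots,\mu_q;x;\rho)=\int_{0}^{\infty}t^{x-1}\,{}_{p}^{\alpha}M^{\beta}_{q}\left(\kappa_{1},\ldots,\kappa_{p};\mu_{1},\ldots,\mu_{q};-t-\frac{\rho}{t}\right)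 dt,$$ and the modified beta (M-beta) function is $${}^{M}B_{p,q}^{(\alpha,\beta)}(x,y;\rho)={}^{M}B_{p,q}^{(\alpha,\beta)}(\kappa_{1},\ldots,\kappa_p;\mu_1,\ldots,\mu_q;x,y;\rho)=\int_{0}^{1}t^{x-1}(1-t)^{y-1}\,{}_{p}^{\alpha}M^{\beta}_{q}\left(\kappa_{1},\ldots,\kappa_{p};\mu_{1},\ldots,\mu_{q};\frac{-\rho}{t(1-t)}\right) dt.$$ These functions are defined for those parameters and arguments for which the series and integrals converge. *)

(* Defs.v *)
(* Stdlib reals with Coquelicot.  All integrals are improper Riemann integrals
   of complex-valued functions ([is_RInt_gen] on C seen as a real normed space),
   so conditionally convergent integrals are allowed. *)
From Stdlib Require Import Reals List ZArith.
From Coquelicot Require Import Coquelicot.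

Open Scope R_scope.

Definition Cexp (z : C) : C :=
  (exp (Re z) * cos (Im z), exp (Re z) * sin (Im z)).

(* Principal value of t ^ z; only meaningful for t > 0. *)
Definition Rcpow (t : R) (z : C) : C := Cexp (z * RtoC (ln t))%C.

Definition is_CInt (f : R -> C) (Fa Fb : (R -> Prop) -> Prop) (l : C) : Prop :=
  is_RInt_gen (V := C_R_CompleteNormedModule) f Fa Fb l.

Definition ex_CInt (f : R -> C) (Fa Fb : (R -> Prop) -> Prop) : Prop :=
  exists l : C, is_CInt f Fa Fb l.

Definition CInt (f : R -> C) (Fa Fb : (R -> Prop) -> Prop) : C :=
  RInt_gen (V := C_R_CompleteNormedModule) f Fa Fb.

Definition ex_Cseries (a : nat -> C) : Prop :=
  ex_series (V := C_CompleteNormedModule) a.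

Definition Cseries (a : nat -> C) : C :=
  iota (T := C_CompleteNormedModule) (is_series (V := C_CompleteNormedModule) a).

Definition nonpos_integer (z : C) : Prop := exists n : nat, z = RtoC (- INR n).

(* Euler's integral; converges for Re z > 0. *)
Definition Gamma_integral (z : C) : C :=
  CInt (fun t => Rcpow t (z - 1) * RtoC (exp (- t)))%C
       (at_right 0) (Rbar_locally p_infty).

Fixpoint rising (z : C) (n : nat) : C :=
  match n with
  | O => RtoC 1
  | S k => (rising z k * (z + RtoC (INR k)))%C
  end.

(* Analytic continuation by Gamma (z + n) = z (z + 1) ... (z + n - 1) Gamma z,
   with n the least natural number such that Re z + n > 0.  At the poles
   0, -1, -2, ... the denominator vanishes and, since [Cinv 0 = 0], both
   [Gamma z] and [/ Gamma z] are 0: this is the usual convention 1/Gamma = 0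
   there, needed for the finitely many m with alpha m + beta a pole. *)
Definition Gamma (z : C) : C :=
  let n := Z.to_nat (up (- Re z)) in
  (Gamma_integral (z + RtoC (INR n)) / rising z n)%C.

Definition Pochhammer (l : C) (m : nat) : C :=
  match m with
  | O => RtoC 1
  | S _ => (Gamma (l + RtoC (INR m)) / Gamma l)%C
  end.

Definition Pochhammer_prod (ls : list C) (m : nat) : C :=
  fold_right (fun l acc => (Pochhammer l m * acc)%C) (RtoC 1) ls.

(* The numbers p and q of parameters are the lengths of [kappa] and [mu]. *)
Definition M_term (kappa mu : list C) (alpha beta z : C) (m : nat) : C :=
  (Pochhammer_prod kappa m / Pochhammer_prod mu m
   * (Cpow z m / Gamma (alpha * RtoC (INR m) + beta)))%C.

Definition M_series (kappa mu : list C) (alpha beta z : C) : C :=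
  Cseries (M_term kappa mu alpha beta z).

Definition Beta_integrand (x y : C) (t : R) : C :=
  (Rcpow t (x - 1) * Rcpow (1 - t) (y - 1))%C.

Definition Beta (x y : C) : C :=
  CInt (Beta_integrand x y) (at_right 0) (at_left 1).

Definition M_gamma_integrand (kappa mu : list C) (alpha beta x rho : C)
    (t : R) : C :=
  (Rcpow t (x - 1)
   * M_series kappa mu alpha beta (- RtoC t - rho / RtoC t))%C.

Definition M_gamma (kappa mu : list C) (alpha beta x rho : C) : C :=
  CInt (M_gamma_integrand kappa mu alpha beta x rho)
       (at_right 0) (Rbar_locally p_infty).

Definition M_beta_integrand (kappa mu : list C) (alpha beta x y rho : C)
    (t : R) : C :=
  (Rcpow t (x - 1) * Rcpow (1 - t) (y - 1)
   * M_series kappa mu alpha beta (- rho / RtoC (t * (1 - t))))%C.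

Definition M_beta (kappa mu : list C) (alpha beta x y rho : C) : C :=
  CInt (M_beta_integrand kappa mu alpha beta x y rho) (at_right 0) (at_left 1).

(* Main.v *)
(** The substance is that the integral defining M_gamma may converge only
    conditionally at infinity, so Fubini is not available.  Write
    h(u) = u^(s-1) M(-u) and let H be the primitive of h vanishing at 0+; it is
    bounded and tends to the value L of M_gamma(s; 0) at infinity.  With
    w = t(1-t), the substitution u = rho/w turns rho^(s-1) times the M_beta
    integrand into k(rho,t) = b(t) h(rho/w)/w, where b is the Beta integrand at
    (x+s, y+s).  Integrating by parts against H(rho/w) bounds the tails of
    the t-integral of k near 0 and 1 uniformly for rho in compact subsets of
    (0,oo).  Hence M_beta exists and the integral of rho^(s-1) M_beta(rho)
    over [a,b] is the limit of those with t cut off, for which Fubini is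
    elementary: it equals J(b) - J(a) with J(rho) the integral of b(t) H(rho/w), which
    converges absolutely.  Finally J(a) -> 0 and J(b) -> B(x+s,y+s) L. *)

(* Since d/dt H(rho/w) = -rho (1 - 2t) w^(-2) h(rho/w), integrating by parts means dividing by 1 -
   2t, which vanishes at t = 1/2. The tail estimate is therefore confined to t <= 1/4 and carried to
   the other end by t -> 1 - t, which exchanges the two Beta exponents. The estimate also carries a
   factor 1/rho: it is uniform for rho >= a > 0 but degenerates as rho -> 0. J has no such factor,
   which is why a and b are sent to their limits only after the rho-integral has been evaluated. The
   two limits of J differ in nature. As rho -> oo, rho/w > rho makes H(rho/w) close to L for all t
   at once. As rho -> 0, rho/w is still unbounded near t = 0 and t = 1, so neighbourhoods of these
   endpoints are cut away using the bound on H. Continuity of h comes from convergence of the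
   M-series on the negative axis, which already forces an infinite radius of convergence. *)
Require Import Defs.
From Stdlib Require Import Reals List Lra.
From Coquelicot Require Import Coquelicot.

(* [ring] and [field] do not recognise [C] behind a Coquelicot structure projection. *)
Ltac as_C := match goal with |- ?a = ?b => change (@eq C a b) end.

(** * Complex-valued functions of a real variable *)

(** The norm of a product module is Euclidean, so on C it is exactly the modulus, and estimates lose
    no constant in passing between the two. *)
Lemma norm_C_R (z : C) : norm (V := C_R_NormedModule) z = Cmod z.
Proof.
  unfold norm; simpl; unfold prod_norm, Cmod; simpl.
  f_equal; unfold norm; simpl; unfold abs; simpl.
  rewrite !Rmult_1_r, <- !Rabs_mult, !Rabs_pos_eq; try apply Rle_0_sqr; reflexivity.
Qed.

Lemma is_derive_C_pair (f : R -> C) (x : R) (l : C) :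
  is_derive (fun t => Re (f t)) x (Re l) ->
  is_derive (fun t => Im (f t)) x (Im l) ->
  is_derive (V := C_R_NormedModule) f x l.
Proof.
  intros H1 H2.
  apply is_derive_ext with (fun t => (Re (f t), Im (f t))).
  { intros t; destruct (f t); reflexivity. }
  unfold is_derive.
  apply filterdiff_ext_lin with (fun y : R => (scal y (Re l), scal y (Im l))).
  2: { intros y; destruct l; reflexivity. }
  apply (filterdiff_comp'_2 (W := C_R_NormedModule) (fun t => Re (f t)) (fun t => Im (f t))
    (fun u v => (u, v)) x (fun y => scal y (Re l)) (fun y => scal y (Im l)) (fun u v => (u, v)) H1 H2).
  apply (filterdiff_linear (V := C_R_NormedModule) (fun t : prod_NormedModule R_AbsRing R_NormedModule R_NormedModule => (fst t, snd t))).
  split.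
  - intros [a b] [c d]; reflexivity.
  - intros k [a b]; reflexivity.
  - exists 1; split; [lra|]. intros [a b]; simpl. rewrite Rmult_1_l; apply Rle_refl.
Qed.

Lemma is_derive_Re (f : R -> C) (x : R) (l : C) :
  is_derive (V := C_R_NormedModule) f x l -> is_derive (fun t => Re (f t)) x (Re l).
Proof.
  intros H.
  apply (filterdiff_comp' f (fun z : C_R_NormedModule => fst z) x _ (fun z => fst z) H).
  apply filterdiff_linear, (is_linear_fst (U := R_NormedModule) (V := R_NormedModule)).
Qed.

Lemma is_derive_Im (f : R -> C) (x : R) (l : C) :
  is_derive (V := C_R_NormedModule) f x l -> is_derive (fun t => Im (f t)) x (Im l).
Proof.
  intros H.
  apply (filterdiff_comp' f (fun z : C_R_NormedModule => snd z) x _ (fun z => snd z) H).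
  apply filterdiff_linear, (is_linear_snd (U := R_NormedModule) (V := R_NormedModule)).
Qed.

Lemma is_derive_Cmult (f g : R -> C) (x : R) (df dg : C) :
  is_derive (V := C_R_NormedModule) f x df ->
  is_derive (V := C_R_NormedModule) g x dg ->
  is_derive (V := C_R_NormedModule) (fun t => f t * g t)%C x (df * g x + f x * dg)%C.
Proof.
  intros Hf Hg.
  pose proof (is_derive_Re _ _ _ Hf); pose proof (is_derive_Im _ _ _ Hf).
  pose proof (is_derive_Re _ _ _ Hg); pose proof (is_derive_Im _ _ _ Hg).
  assert (Hm : forall (u v : R -> R) (du dv : R), is_derive u x du -> is_derive v x dv ->
     is_derive (fun t => u t * v t) x (du * v x + u x * dv)).
  { intros u v du dv Hu Hv. apply (is_derive_mult u v); auto. intros; apply Rmult_comm. }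
  apply is_derive_C_pair.
  - evar_last.
    apply (is_derive_minus (fun t => Re (f t) * Re (g t)) (fun t => Im (f t) * Im (g t)));
      apply Hm; eassumption.
    unfold minus, plus, opp; simpl; unfold Re, Im; ring.
  - evar_last.
    apply (is_derive_plus (fun t => Re (f t) * Im (g t)) (fun t => Im (f t) * Re (g t)));
      apply Hm; eassumption.
    unfold minus, plus, opp; simpl; unfold Re, Im; ring.
Qed.

Lemma is_derive_RtoC (f : R -> R) (x l : R) :
  is_derive f x l -> is_derive (V := C_R_NormedModule) (fun t => RtoC (f t)) x (RtoC l).
Proof.
  intros H; apply is_derive_C_pair; simpl; [exact H|].
  apply (is_derive_const (V := R_NormedModule)).
Qed.

Lemma continuous_C_pair {U : UniformSpace} (f : U -> C) (x : U) :
  continuous (fun t => Re (f t)) x -> continuous (fun t => Im (f t)) x ->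
  continuous f x.
Proof.
  intros H1 H2.
  apply continuous_ext with (fun t => (Re (f t), Im (f t))).
  { intros t; destruct (f t); reflexivity. }
  apply filterlim_locally; intros e.
  generalize (filter_and _ _ (proj1 (filterlim_locally _ _) H1 e) (proj1 (filterlim_locally _ _) H2 e)).
  apply filter_imp; intros t [a b]; split; assumption.
Qed.

Lemma continuous_Re {U : UniformSpace} (f : U -> C) (x : U) :
  continuous f x -> continuous (fun t => Re (f t)) x.
Proof.
  intros H; apply (continuous_comp f (fun z : C_UniformSpace => fst z)); auto.
  destruct (f x); apply continuous_fst.
Qed.

Lemma continuous_Im {U : UniformSpace} (f : U -> C) (x : U) :
  continuous f x -> continuous (fun t => Im (f t)) x.
Proof.
  intros H; apply (continuous_comp f (fun z : C_UniformSpace => snd z)); auto.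
  destruct (f x); apply continuous_snd.
Qed.

Lemma continuous_Cmult {U : UniformSpace} (f g : U -> C) (x : U) :
  continuous f x -> continuous g x -> continuous (fun t => f t * g t)%C x.
Proof.
  intros Hf Hg.
  pose proof (continuous_Re _ _ Hf); pose proof (continuous_Im _ _ Hf).
  pose proof (continuous_Re _ _ Hg); pose proof (continuous_Im _ _ Hg).
  apply continuous_C_pair; simpl.
  - apply (continuous_minus (V := R_NormedModule)); apply (continuous_mult (K := R_AbsRing)); assumption.
  - apply (continuous_plus (V := R_NormedModule)); apply (continuous_mult (K := R_AbsRing)); assumption.
Qed.

Lemma continuous_RtoC {U : UniformSpace} (f : U -> R) (x : U) :
  continuous f x -> continuous (fun t => RtoC (f t)) x.
Proof. intros H; apply continuous_C_pair; simpl; [exact H|apply continuous_const]. Qed.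

(** The scalar is complex while integrals live in a real module, so linearity is obtained from the
    real and imaginary parts. *)
Lemma is_RInt_Cmult_l (c : C) (f : R -> C) (a b : R) (l : C) :
  is_RInt (V := C_R_NormedModule) f a b l ->
  is_RInt (V := C_R_NormedModule) (fun t => c * f t)%C a b (c * l)%C.
Proof.
  intros H.
  pose proof (is_RInt_fct_extend_fst f a b l H) as H1.
  pose proof (is_RInt_fct_extend_snd f a b l H) as H2.
  assert (Hs : forall k (u : R -> R) v, is_RInt u a b v -> is_RInt (fun t => k * u t) a b (k * v)).
  { intros; apply (is_RInt_scal (V := R_NormedModule)); assumption. }
  apply (is_RInt_fct_extend_pair (U := R_NormedModule) (V := R_NormedModule)).
  - apply (is_RInt_minus (V := R_NormedModule) (fun t => fst c * fst (f t)) (fun t => snd c * snd (f t))); apply Hs; assumption.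
  - apply (is_RInt_plus (V := R_NormedModule) (fun t => fst c * snd (f t)) (fun t => snd c * fst (f t))); apply Hs; assumption.
Qed.

(** * Complex exponential and complex powers of positive reals *)

Lemma Cexp_plus (z w : C) : Cexp (z + w)%C = (Cexp z * Cexp w)%C.
Proof.
  destruct z as [a b], w as [c d]; unfold Cexp, Cmult; simpl.
  rewrite exp_plus, cos_plus, sin_plus.
  apply injective_projections; simpl; ring.
Qed.

Lemma Cmod_Cexp (z : C) : Cmod (Cexp z) = exp (Re z).
Proof.
  unfold Cexp, Cmod; simpl fst; simpl snd.
  rewrite !Rpow_mult_distr, <- Rmult_plus_distr_l, Rplus_comm, <- !Rsqr_pow2, sin2_cos2, Rmult_1_r.
  apply sqrt_Rsqr, Rlt_le, exp_pos.
Qed.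

Lemma Rcpow_plus (t : R) (z w : C) : Rcpow t (z + w)%C = (Rcpow t z * Rcpow t w)%C.
Proof. unfold Rcpow; rewrite <- Cexp_plus; f_equal; ring. Qed.

Lemma Rcpow_mult (a b : R) (z : C) : 0 < a -> 0 < b -> Rcpow (a * b) z = (Rcpow a z * Rcpow b z)%C.
Proof.
  intros Ha Hb; unfold Rcpow; rewrite <- Cexp_plus, ln_mult, RtoC_plus by assumption.
  f_equal; ring.
Qed.

Lemma Rcpow_1 (t : R) : 0 < t -> Rcpow t 1 = RtoC t.
Proof.
  intros Ht; unfold Rcpow, Cexp; rewrite Cmult_1_l; simpl.
  rewrite exp_ln, cos_0, sin_0, Rmult_1_r, Rmult_0_r by assumption; reflexivity.
Qed.

Lemma Cmod_Rcpow (t : R) (z : C) : Cmod (Rcpow t z) = Rpower t (Re z).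
Proof. unfold Rcpow; rewrite Cmod_Cexp; unfold Rpower; f_equal; destruct z; simpl; ring. Qed.

Lemma is_derive_Rcpow (z : C) (t : R) : 0 < t ->
  is_derive (V := C_R_NormedModule) (fun t => Rcpow t z) t (z * Rcpow t (z - 1))%C.
Proof.
  intros Ht.
  (* The chain rule through [ln t] produces a factor 1/t, so the target is put in that form. *)
  replace (z * Rcpow t (z - 1))%C with (z * Rcpow t z * RtoC (/ t))%C.
  2: { replace z with ((z - 1) + 1)%C at 2 by ring.
       rewrite Rcpow_plus, Rcpow_1, RtoC_inv by lra.
       field; intros E; apply RtoC_inj in E; lra. }
  destruct z as [u v].
  apply is_derive_C_pair; unfold Rcpow, Cexp; simpl; auto_derive; try (repeat split; assumption);
    unfold Rminus; field; lra.
Qed.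

Lemma continuous_Rcpow (z : C) (t : R) : 0 < t -> continuous (fun t => Rcpow t z) t.
Proof.
  intros Ht.
  apply (ex_derive_continuous (V := C_R_NormedModule)).
  eexists; apply is_derive_Rcpow; exact Ht.
Qed.

(** * Limits and integrals in terms of the modulus *)

Notation RIntC := (RInt (V := C_R_CompleteNormedModule)).
Notation ex_RIntC := (ex_RInt (V := C_R_CompleteNormedModule)).

Lemma filterlim_Cmod {T : Type} {F : (T -> Prop) -> Prop} {FF : Filter F} (f : T -> C) (l : C) :
  filterlim f F (locally l) <-> forall eps, 0 < eps -> F (fun x => Cmod (f x - l) < eps).
Proof.
  rewrite (filterlim_locally_ball_norm (U := C_R_NormedModule)).
  split.
  - intros H eps He; generalize (H (mkposreal eps He)); apply filter_imp.
    intros x; unfold ball_norm; rewrite norm_C_R; trivial.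
  - intros H eps; generalize (H eps (cond_pos eps)); apply filter_imp.
    intros x; unfold ball_norm; rewrite norm_C_R; trivial.
Qed.

Lemma filterlim_C_cauchy {T : Type} {F : (T -> Prop) -> Prop} {FF : ProperFilter F} (f : T -> C) :
  (forall eps, 0 < eps -> exists P, F P /\ forall u v, P u -> P v -> Cmod (f u - f v) < eps) ->
  exists l : C, filterlim f F (locally l).
Proof.
  intros H.
  apply (filterlim_locally_cauchy (U := C_R_CompleteNormedModule)); intros eps.
  destruct (H eps (cond_pos eps)) as [P [HP HC]]; exists P; split; [exact HP|].
  intros u v Hu Hv.
  apply (norm_compat1 (V := C_R_NormedModule)); rewrite norm_C_R; apply HC; assumption.
Qed.

Lemma RIntC_Chasles (f : R -> C) (a b c : R) :
  ex_RIntC f a b -> ex_RIntC f b c -> RIntC f a c = (RIntC f a b + RIntC f b c)%C.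
Proof. intros H1 H2; symmetry; exact (RInt_Chasles (V := C_R_CompleteNormedModule) f a b c H1 H2). Qed.

Lemma Cmod_RIntC_le (f : R -> C) (g : R -> R) (a b l : R) :
  a <= b -> ex_RIntC f a b -> is_RInt g a b l ->
  (forall t, a <= t <= b -> Cmod (f t) <= g t) ->
  Cmod (RIntC f a b) <= l.
Proof.
  intros Hab Hf Hg Hle; rewrite <- norm_C_R.
  apply (norm_RInt_le (V := C_R_NormedModule) f g a b); auto.
  - intros t Ht; rewrite norm_C_R; auto.
  - apply (RInt_correct (V := C_R_CompleteNormedModule) f a b), Hf.
Qed.

Lemma Cmod_sub_triangle (a b c : C) : Cmod (a - c) <= Cmod (a - b) + Cmod (b - c).
Proof. replace (a - c)%C with ((a - b) + (b - c))%C by ring; apply Cmod_triangle. Qed.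

Lemma Cmod_sub_sym (a b : C) : Cmod (a - b) = Cmod (b - a).
Proof. rewrite <- Cmod_opp; f_equal; ring. Qed.

(** * Improper integrals over (0,1) *)

Lemma at_right_interval (a b : R) : a < b -> at_right a (fun t => a < t < b).
Proof.
  intros Hab.
  exists (mkposreal (b - a) (proj2 (Rlt_0_minus _ _) Hab)).
  intros t Ht Hat; split; [exact Hat|].
  apply Rabs_def2 in Ht; unfold minus, plus, opp in Ht; simpl in Ht; lra.
Qed.

Lemma at_left_interval (a b : R) : a < b -> at_left b (fun t => a < t < b).
Proof.
  intros Hab.
  exists (mkposreal (b - a) (proj2 (Rlt_0_minus _ _) Hab)).
  intros t Ht Hat; split; [|exact Hat].
  apply Rabs_def2 in Ht; unfold minus, plus, opp in Ht; simpl in Ht; lra.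
Qed.

Lemma filterlim_one_minus : filterlim (fun d => 1 - d) (at_left 1) (at_right 0).
Proof.
  intros P [e He]. exists e; intros d Hd Hd1; apply He; [|lra].
  apply Rabs_def2 in Hd; unfold minus, plus, opp in Hd; simpl in Hd.
  apply Rabs_def1; unfold minus, plus, opp; simpl; lra.
Qed.

Lemma ex_RIntC_unit (f : R -> C) (c d : R) :
  (forall t, 0 < t < 1 -> continuous f t) -> 0 < c < 1 -> 0 < d < 1 -> ex_RIntC f c d.
Proof.
  intros Hf Hc Hd; apply (ex_RInt_continuous (V := C_R_CompleteNormedModule)); intros z Hz; apply Hf.
  revert Hz; apply Rmin_case; apply Rmax_case; lra.
Qed.

(** Cauchy criterion with one modulus [om] for both ends. The explicit error in the conclusion is
    what later gives uniformity in rho; 1/4 keeps the tails away from t = 1/2, where the kernel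
    estimate breaks down. *)
Lemma is_CInt_unit_tails (f : R -> C) (om : R -> R) :
  (forall t, 0 < t < 1 -> continuous f t) ->
  filterlim om (at_right 0) (locally 0) ->
  (forall c d, 0 < c <= d -> d <= 1/4 -> Cmod (RIntC f c d) <= om d) ->
  (forall c d, 0 < c <= d -> d <= 1/4 -> Cmod (RIntC f (1 - d) (1 - c)) <= om d) ->
  exists I : C, is_CInt f (at_right 0) (at_left 1) I /\
    forall c d, 0 < c <= 1/4 -> 3/4 <= d < 1 ->
      Cmod (RIntC f c d - I) <= om c + om (1 - d).
Proof.
  intros Hf Hom H0 H1.
  (* Enlarging an interval adds two tails, each controlled by [om] at the inner endpoint. *)
  assert (Key : forall c d c' d', 0 < c' <= c -> c <= 1/4 -> 3/4 <= d <= d' -> d' < 1 ->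
     Cmod (RIntC f c d - RIntC f c' d') <= om c + om (1 - d)).
  { intros c d c' d' Hc Hc4 Hd Hd1.
    rewrite (RIntC_Chasles f c' c d'), (RIntC_Chasles f c d d') by (apply ex_RIntC_unit; auto; lra).
    replace (_ - _)%C with (- (RIntC f c' c) + - RIntC f d d')%C by ring.
    eapply Rle_trans; [apply Cmod_triangle|]. rewrite !Cmod_opp.
    apply Rplus_le_compat; [apply H0; lra|].
    replace d with (1 - (1 - d)) at 1 by ring; replace d' with (1 - (1 - d')) by ring.
    apply H1; lra. }
  assert (Small : forall eps, 0 < eps -> filter_prod (at_right 0) (at_left 1)
     (fun z => 0 < fst z <= 1/4 /\ om (fst z) < eps /\ 3/4 <= snd z < 1 /\ om (1 - snd z) < eps)).
  { intros eps Heps.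
    assert (Ho : at_right 0 (fun t => om t < eps)).
    { generalize (proj1 (filterlim_locally _ _) Hom (mkposreal eps Heps)); apply filter_imp.
      intros t Ht; apply Rabs_def2 in Ht; unfold minus, plus, opp in Ht; simpl in Ht; lra. }
    apply Filter_prod with (fun c => 0 < c < 1/4 /\ om c < eps) (fun d => 3/4 < d < 1 /\ om (1 - d) < eps).
    - apply filter_and; [apply at_right_interval; lra|exact Ho].
    - apply filter_and; [apply at_left_interval; lra|exact (filterlim_one_minus _ Ho)].
    - simpl; intros; lra. }
  destruct (filterlim_C_cauchy (F := filter_prod (at_right 0) (at_left 1))
     (fun z => RIntC f (fst z) (snd z))) as [I HI].
  { intros eps Heps.
    eexists; split; [apply (Small (eps / 4)); lra|].
    intros [c d] [c' d']; simpl; intros (a1 & a2 & a3 & a4) (b1 & b2 & b3 & b4).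
    (* Two intervals need not be nested, so both are compared with their hull [m, M]; this costs
       four tails, each below eps/4. *)
    set (m := Rmin c c'); set (M := Rmax d d').
    assert (m <= c /\ m <= c' /\ 0 < m) as (m1 & m2 & m3).
    { unfold m; repeat split; [apply Rmin_l|apply Rmin_r|apply Rmin_pos; lra]. }
    assert (d <= M /\ d' <= M /\ M < 1) as (M1 & M2 & M3).
    { unfold M; repeat split; [apply Rmax_l|apply Rmax_r|apply Rmax_lub_lt; lra]. }
    eapply Rle_lt_trans; [apply (Cmod_sub_triangle _ (RIntC f m M))|].
    rewrite (Cmod_sub_sym (RIntC f m M)).
    generalize (Key c d m M) (Key c' d' m M). lra. }
  exists I; split.
  (* [is_CInt] is a limit of the relation [is_RInt]; near the endpoints the total function [RIntC]
     satisfies that relation, so its ordinary limit suffices. *)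
  - apply (filterlimi_lim_ext_loc (fun z => RIntC f (fst z) (snd z))); [|exact HI].
    generalize (Small 1 Rlt_0_1); apply filter_imp; intros z Hz.
    apply (RInt_correct (V := C_R_CompleteNormedModule)), ex_RIntC_unit; auto; lra.
  - intros c d Hc Hd; apply le_epsilon; intros eps Heps.
    assert (Hnear : filter_prod (at_right 0) (at_left 1)
      (fun z => Cmod (RIntC f (fst z) (snd z) - I) < eps)).
    { apply (proj1 (filterlim_Cmod _ _) HI eps Heps). }
    assert (Hout : filter_prod (at_right 0) (at_left 1) (fun z => 0 < fst z < c /\ d < snd z < 1)).
    { exact (Filter_prod _ _ _ _ _ (at_right_interval 0 c (proj1 Hc)) (at_left_interval d 1 (proj2 Hd))
          (fun x y a b => conj a b)). }
    destruct (filter_ex _ (filter_and _ _ Hnear Hout))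
      as [[c' d'] [Hb Hcd]]; simpl in *.
    eapply Rle_trans; [apply (Cmod_sub_triangle _ (RIntC f c' d'))|].
    generalize (Key c d c' d'); lra.
Qed.

(** * Tails of the kernel *)

Lemma is_derive_C_comp (f : R -> C) (g : R -> R) (x dg : R) (df : C) :
  is_derive g x dg -> is_derive (V := C_R_NormedModule) f (g x) df ->
  is_derive (V := C_R_NormedModule) (fun t => f (g t)) x (RtoC dg * df)%C.
Proof.
  intros Hg Hf; evar_last; [apply (is_derive_comp (V := C_R_NormedModule)); eassumption|].
  apply scal_R_Cmult.
Qed.

Lemma is_RInt_power (A e c d : R) : 0 < e -> 0 < c <= d ->
  is_RInt (fun t => A * Rpower t (e - 1)) c d (A / e * Rpower d e - A / e * Rpower c e).
Proof.
  intros He Hc.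
  apply (is_RInt_derive (fun t => A / e * Rpower t e)).
  - intros t; rewrite Rmin_left, Rmax_right by lra; intros Ht.
    replace (Rpower t (e - 1)) with (Rpower t e / t).
    2: { unfold Rminus; rewrite Rpower_plus, Rpower_Ropp, Rpower_1 by lra; reflexivity. }
    unfold Rpower; auto_derive; [lra|field; lra].
  - intros t; rewrite Rmin_left, Rmax_right by lra; intros Ht.
    apply (ex_derive_continuous (fun t => A * Rpower t (e - 1))).
    unfold Rpower; auto_derive; lra.
Qed.

(** Discarding the nonnegative term at [c] leaves a bound independent of the lower endpoint, as a
    tail at 0 requires. *)
Lemma Cmod_RIntC_power_le (f : R -> C) (A e c d : R) : 0 < e -> 0 < c <= d -> 0 <= A ->
  ex_RIntC f c d -> (forall t, c <= t <= d -> Cmod (f t) <= A * Rpower t (e - 1)) ->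
  Cmod (RIntC f c d) <= A / e * Rpower d e.
Proof.
  intros He Hc HA Hf Hle.
  eapply Rle_trans.
  - apply (Cmod_RIntC_le f _ c d _ (proj2 Hc) Hf (is_RInt_power A e c d He Hc) Hle).
  - assert (0 <= A / e * Rpower c e); [|lra].
    apply Rmult_le_pos; [apply Rdiv_le_0_compat; lra|apply Rlt_le, exp_pos].
Qed.

Lemma filterlim_Rpower_0 (e : R) : 0 < e -> filterlim (fun t => Rpower t e) (at_right 0) (locally 0).
Proof.
  intros He; unfold Rpower.
  apply (filterlim_comp _ _ _ (fun t => e * ln t) exp _ (Rbar_locally m_infty)).
  - apply (filterlim_comp _ _ _ ln (fun t => e * t) _ (Rbar_locally m_infty)).
    + apply is_lim_ln_0.
    + replace m_infty with (Rbar_mult e m_infty) at 2; [apply filterlim_Rbar_mult_l|].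
      apply is_Rbar_mult_unique, (is_Rbar_mult_sym m_infty e), is_Rbar_mult_m_infty_pos; exact He.
  - apply is_lim_exp_m.
Qed.

Lemma RIntC_reflect (f : R -> C) (c d : R) :
  ex_RIntC f (1 - d) (1 - c) -> RIntC f (1 - d) (1 - c) = RIntC (fun t => f (1 - t)) c d.
Proof.
  intros H; symmetry.
  assert (H1 : is_RInt (V := C_R_NormedModule) f (-1 * d + 1) (-1 * c + 1) (RIntC f (1 - d) (1 - c))).
  { replace (-1 * d + 1) with (1 - d) by ring; replace (-1 * c + 1) with (1 - c) by ring.
    apply (RInt_correct (V := C_R_CompleteNormedModule)), H. }
  (* The substitution reverses the limits and brings a factor -1; swapping and negating undo
     both. *)
  apply (is_RInt_comp_lin (V := C_R_NormedModule)) in H1.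
  apply (is_RInt_swap (V := C_R_NormedModule)), (is_RInt_opp (V := C_R_NormedModule)) in H1.
  apply (is_RInt_unique (V := C_R_CompleteNormedModule)).
  rewrite opp_opp in H1; revert H1.
  apply (is_RInt_ext (V := C_R_NormedModule)); intros t _.
  replace (-1 * t + 1) with (1 - t) by ring.
  destruct (f (1 - t)) as [u v].
  unfold opp, scal; simpl; unfold prod_opp, prod_scal; simpl.
  unfold opp, scal; simpl; unfold mult; simpl; f_equal; ring.
Qed.

Lemma continuous_Beta_integrand (x y : C) (t : R) : 0 < t < 1 -> continuous (Beta_integrand x y) t.
Proof.
  intros Ht; apply continuous_Cmult; [apply continuous_Rcpow; lra|].
  apply (continuous_comp (fun t => 1 - t) (fun t => Rcpow t (y - 1))); [|apply continuous_Rcpow; lra].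
  apply (ex_derive_continuous (fun t => 1 - t)); auto_derive; trivial.
Qed.

(** By this symmetry every estimate at 1 is the one at 0 with the exponents exchanged. *)
Lemma Beta_integrand_reflect (x y : C) (t : R) : Beta_integrand x y (1 - t) = Beta_integrand y x t.
Proof.
  unfold Beta_integrand; replace (1 - (1 - t)) with t by ring; apply Cmult_comm.
Qed.

Lemma Rexp_le (a b : R) : a <= b -> exp a <= exp b.
Proof.
  intros [H| ->]; [left; apply exp_increasing, H|right; reflexivity].
Qed.

(* Bounds [|(1 - t)^(y - 1)|] for [0 < t <= 1/2]. *)
Definition half_bound (y : C) : R := exp (Rabs (Re y - 1) * ln 2).

(** For t <= 1/2 the logarithm of 1 - t has absolute value at most ln 2, so (1 - t)^(Re y - 1) is at
    most 2^|Re y - 1| whatever the sign of the exponent. *)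
Lemma Cmod_Beta_integrand_le (x y : C) (t : R) : 0 < t <= 1/2 ->
  Cmod (Beta_integrand x y t) <= half_bound y * Rpower t (Re x - 1).
Proof.
  intros Ht; unfold Beta_integrand; rewrite Cmod_mult, !Cmod_Rcpow, Rmult_comm.
  replace (Re (x - 1)) with (Re x - 1) by (destruct x; reflexivity).
  replace (Re (y - 1)) with (Re y - 1) by (destruct y; reflexivity).
  apply Rmult_le_compat_r; [apply Rlt_le, exp_pos|].
  unfold half_bound, Rpower; apply Rexp_le.
  eapply Rle_trans; [apply Rle_abs|]. rewrite Rabs_mult.
  apply Rmult_le_compat_l; [apply Rabs_pos|].
  assert (ln (1 - t) <= 0) by (rewrite <- ln_1; apply ln_le; lra).
  rewrite Rabs_left1 by assumption.
  rewrite <- ln_Rinv by lra.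
  apply ln_le; [apply Rinv_0_lt_compat; lra|].
  replace 2 with (/ / 2) by field. apply Rinv_le_contravar; lra.
Qed.

(** The function k of the overview for an arbitrary [h]; the M-series enters later, by choosing h(u)
    = u^(s-1) M(-u). *)
Definition Mellin_kern (X Y : C) (h : R -> C) (rho t : R) : C :=
  (Beta_integrand X Y t * RtoC (/ (t * (1 - t))) * h (rho / (t * (1 - t)))%R)%C.

Lemma kern_reflect (X Y : C) (h : R -> C) (rho t : R) : Mellin_kern X Y h rho (1 - t) = Mellin_kern Y X h rho t.
Proof.
  unfold Mellin_kern; rewrite Beta_integrand_reflect; replace ((1 - t) * (1 - (1 - t))) with (t * (1 - t)) by ring.
  reflexivity.
Qed.

Lemma unit_prod_pos (t : R) : 0 < t < 1 -> 0 < t * (1 - t).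
Proof. intros; apply Rmult_lt_0_compat; lra. Qed.

Lemma unit_ratio_pos (rho t : R) : 0 < rho -> 0 < t < 1 -> 0 < rho / (t * (1 - t)).
Proof. intros; apply Rdiv_lt_0_compat; [|apply unit_prod_pos]; assumption. Qed.

Lemma continuous_unit_ratio (rho t : R) : 0 < t < 1 -> continuous (fun t => rho / (t * (1 - t))) t.
Proof.
  intros Ht; apply (ex_derive_continuous (fun t => rho / (t * (1 - t)))).
  auto_derive; apply Rgt_not_eq, unit_prod_pos, Ht.
Qed.

Lemma continuous_kern (X Y : C) (h : R -> C) (rho t : R) :
  (forall u, 0 < u -> continuous h u) -> 0 < rho -> 0 < t < 1 -> continuous (Mellin_kern X Y h rho) t.
Proof.
  intros Hh Hrho Ht; apply continuous_Cmult; [apply continuous_Cmult|].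
  - apply continuous_Beta_integrand, Ht.
  - apply continuous_RtoC.
    apply (ex_derive_continuous (fun t => / (t * (1 - t)))).
    auto_derive; apply Rgt_not_eq, unit_prod_pos, Ht.
  - apply (continuous_comp (fun t => rho / (t * (1 - t))) h).
    + apply continuous_unit_ratio, Ht.
    + apply Hh, unit_ratio_pos; assumption.
Qed.

(** The 4 collects the two boundary terms of the integration by parts, 2 for each. The quotient
    comes from the integral of g' H(rho/w): the numerator bounds the coefficient of the Beta
    integrand in g' on (0, 1/4], and integrating t^(Re X - 1) gives the divisor Re X. *)
Definition tail_const (X Y : C) : R :=
  half_bound Y * (4 + (2 * Cmod X + 2 * Cmod Y + 8) / Re X).

Lemma Rcpow_pred (t : R) (z : C) : 0 < t -> Rcpow t z = (RtoC t * Rcpow t (z - 1))%C.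
Proof.
  intros Ht; rewrite <- (Rcpow_1 t) by exact Ht.
  rewrite <- Rcpow_plus; f_equal; ring.
Qed.

(* Integration by parts against [H (rho / (t (1 - t)))]; only the boundedness
   of the primitive [H] is used, since [h] need not be absolutely integrable. *)
Lemma Cmod_RIntC_kern_le (X Y : C) (h H : R -> C) (M rho c d : R) :
  0 < Re X ->
  (forall u, 0 < u -> continuous h u) ->
  (forall u, 0 < u -> is_derive (V := C_R_NormedModule) H u (h u)) ->
  (forall u, 0 < u -> Cmod (H u) <= M) ->
  0 < rho -> 0 < c <= d -> d <= 1/4 ->
  Cmod (RIntC (Mellin_kern X Y h rho) c d) <= M / rho * tail_const X Y * Rpower d (Re X).
Proof.
  intros HX Hh HH HM Hrho Hc Hd.
  assert (M0 : 0 <= M) by (eapply Rle_trans; [apply Cmod_ge_0|apply (HM 1 Rlt_0_1)]).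
  (* Chosen so that g times the t-derivative of H(rho/w) is -rho times the kernel. In closed form g
     = t^X (1 - t)^Y / (1 - 2t), whose derivative is [dg]. *)
  set (g := fun t => (Beta_integrand X Y t * RtoC (t * (1 - t) / (1 - 2 * t)))%C).
  set (dg := fun t => (Beta_integrand X Y t *
     (X * RtoC ((1 - t) / (1 - 2 * t)) - Y * RtoC (t / (1 - 2 * t))
       + RtoC (2 * (t * (1 - t)) / (1 - 2 * t) ^ 2)))%C).
  set (G := fun t => H (rho / (t * (1 - t)))).
  assert (Dg : forall t, 0 < t <= 1/4 -> is_derive (V := C_R_NormedModule) g t (dg t)).
  { intros t Ht.
    apply (is_derive_ext_loc (V := C_R_NormedModule)
      (fun t => (Rcpow t X * Rcpow (1 - t) Y) * RtoC (/ (1 - 2 * t)))%C).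
    (* The two forms of g agree only where u and 1 - u are positive; radius t keeps u in (0, 2t),
       hence in (0, 1/2). *)
    { exists (mkposreal t (proj1 Ht)); intros u Hu.
      apply Rabs_def2 in Hu; unfold minus, plus, opp in Hu; simpl in Hu.
      unfold g, Beta_integrand; rewrite (Rcpow_pred u X), (Rcpow_pred (1 - u) Y) by lra.
      unfold Rdiv; rewrite !RtoC_mult. as_C; ring. }
    assert (Hd1 : is_derive (fun t : R => 1 - t) t (-1)) by (auto_derive; [trivial|ring]).
    evar_last.
    { apply is_derive_Cmult; [apply is_derive_Cmult|apply is_derive_RtoC].
      - apply is_derive_Rcpow; lra.
      - eapply (is_derive_C_comp (fun t => Rcpow t Y)); [exact Hd1|].
        apply is_derive_Rcpow; lra.
      - auto_derive; [lra|reflexivity]. }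
    as_C; cbv beta; rewrite (Rcpow_pred t X), (Rcpow_pred (1 - t) Y) by lra.
    unfold dg, Beta_integrand.
    replace (- - (2 * 1) * / ((1 + - (2 * t)) * (1 + - (2 * t)))) with (2 * (/ (1 - 2 * t) * / (1 - 2 * t))) by (field; lra).
    replace (2 * (t * (1 - t)) / (1 - 2 * t) ^ 2) with (2 * (t * (1 - t)) * (/ (1 - 2 * t) * / (1 - 2 * t))) by (field; lra).
    unfold Rdiv; rewrite ?RtoC_mult.
    generalize (RtoC (/ (1 - 2 * t))); intros i; ring. }
  assert (DG : forall t, 0 < t <= 1/4 -> is_derive (V := C_R_NormedModule) G t
     (RtoC (- rho * (1 - 2 * t) / (t * (1 - t)) ^ 2) * h (rho / (t * (1 - t)))%R)%C).
  { intros t Ht; assert (Hw : 0 < t * (1 - t)) by (apply unit_prod_pos; lra).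
    apply (is_derive_C_comp H (fun t => rho / (t * (1 - t)))); [|apply HH, unit_ratio_pos; lra].
    auto_derive; [lra|field; lra]. }
  (* This is the product rule g' G + g G' with g G' replaced by -rho times the kernel; solving for
     the kernel gives [Ek]. *)
  set (E := fun t => (dg t * G t - RtoC rho * Mellin_kern X Y h rho t)%C).
  assert (DgG : forall t, 0 < t <= 1/4 -> is_derive (V := C_R_NormedModule) (fun t => g t * G t)%C t (E t)).
  { intros t Ht; assert (Hw : 0 < t * (1 - t)) by (apply unit_prod_pos; lra).
    evar_last; [apply is_derive_Cmult; [apply Dg|apply DG]; exact Ht|].
    as_C; unfold E, g, Mellin_kern.
    replace (- rho * (1 - 2 * t) / (t * (1 - t)) ^ 2)
      with (- (rho * ((1 - 2 * t) * (/ (t * (1 - t)) * / (t * (1 - t)))))) by (field; lra).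
    replace (t * (1 - t) / (1 - 2 * t)) with (t * (1 - t) * / (1 - 2 * t)) by reflexivity.
    rewrite RtoC_opp, !RtoC_mult, (RtoC_inv (t * (1 - t))), (RtoC_inv (1 - 2 * t)), (RtoC_mult t) by lra.
    assert (RtoC (1 - 2 * t) <> 0)%C by (intros e; apply RtoC_inj in e; lra).
    assert (RtoC (1 - t) <> 0)%C by (intros e; apply RtoC_inj in e; lra).
    assert (RtoC t <> 0)%C by (intros e; apply RtoC_inj in e; lra).
    field; auto. }
  assert (CG : forall t, 0 < t <= 1/4 -> continuous G t).
  { intros t Ht; apply (ex_derive_continuous (V := C_R_NormedModule)); eexists; apply DG, Ht. }
  assert (Cdg : forall t, 0 < t <= 1/4 -> continuous dg t).
  { intros t Ht; apply continuous_Cmult; [apply continuous_Beta_integrand; lra|].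
    assert (Cr : forall r : R -> R, ex_derive r t -> continuous (fun t => RtoC (r t)) t).
    { intros r Hr; apply continuous_RtoC, (ex_derive_continuous r), Hr. }
    apply (continuous_plus (V := C_R_NormedModule)); [apply (continuous_minus (V := C_R_NormedModule))|];
      [apply continuous_Cmult; [apply continuous_const|]..|];
      apply (Cr (fun t => _)); auto_derive; trivial; try lra.
    nra. }
  assert (Ck : forall t, 0 < t <= 1/4 -> continuous (Mellin_kern X Y h rho) t).
  { intros t Ht; apply continuous_kern; auto; lra. }
  assert (IE : is_RInt (V := C_R_NormedModule) E c d (g d * G d - g c * G c)%C).
  { apply (is_RInt_derive (V := C_R_CompleteNormedModule) (fun t => g t * G t)%C);
      intros t; rewrite Rmin_left, Rmax_right by lra; intros Ht; [apply DgG; lra|].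
    apply (continuous_minus (V := C_R_NormedModule)).
    - apply continuous_Cmult; [apply Cdg|apply CG]; lra.
    - apply continuous_Cmult; [apply continuous_const|apply Ck; lra]. }
  assert (XdgG : ex_RIntC (fun t => dg t * G t)%C c d).
  { apply (ex_RInt_continuous (V := C_R_CompleteNormedModule)); intros t.
    rewrite Rmin_left, Rmax_right by lra; intros Ht.
    apply continuous_Cmult; [apply Cdg|apply CG]; lra. }
  assert (rho0 : RtoC rho <> 0%C) by (intros e; apply RtoC_inj in e; lra).
  assert (Ek : RIntC (Mellin_kern X Y h rho) c d =
    (RtoC (/ rho) * (RIntC (fun t => dg t * G t)%C c d - (g d * G d - g c * G c)))%C).
  { apply (is_RInt_unique (V := C_R_CompleteNormedModule)).
    apply (is_RInt_ext (V := C_R_NormedModule) (fun t => RtoC (/ rho) * (dg t * G t - E t))%C).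
    { intros t _; as_C; unfold E; rewrite RtoC_inv by lra; field; exact rho0. }
    apply is_RInt_Cmult_l, (is_RInt_minus (V := C_R_NormedModule)); [|exact IE].
    apply (RInt_correct (V := C_R_CompleteNormedModule)), XdgG. }
  set (K := half_bound Y); assert (K0 : 0 < K) by apply exp_pos.
  assert (Bb : forall t, c <= t <= d -> Cmod (Beta_integrand X Y t) <= K * Rpower t (Re X - 1)).
  { intros t Ht; apply Cmod_Beta_integrand_le; lra. }
  assert (Bg : forall t, c <= t <= d -> Cmod (g t * G t) <= 2 * K * M * Rpower d (Re X)).
  { intros t Ht; rewrite Cmod_mult.
    replace (2 * K * M * Rpower d (Re X)) with (2 * K * Rpower d (Re X) * M) by ring.
    apply Rmult_le_compat; try apply Cmod_ge_0; [|apply HM, unit_ratio_pos; lra].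
    unfold g; rewrite Cmod_mult, Cmod_R.
    (* The factor t gained here raises t^(Re X - 1) to t^(Re X), so the boundary terms vanish at
       0. *)
    assert (0 <= t * (1 - t) / (1 - 2 * t) <= 2 * t).
    { split; [apply Rdiv_le_0_compat; nra|apply Rle_div_l; nra]. }
    rewrite Rabs_pos_eq by lra.
    apply Rle_trans with (K * Rpower t (Re X - 1) * (2 * t)).
    { apply Rmult_le_compat; try apply Cmod_ge_0; auto; lra. }
    apply Rle_trans with (2 * K * Rpower t (Re X)).
    { right; rewrite <- (Rpower_1 t) at 2 by lra.
      replace (Rpower t (Re X)) with (Rpower t (Re X - 1) * Rpower t 1); [ring|].
      rewrite <- Rpower_plus; f_equal; ring. }
    apply Rmult_le_compat_l; [lra|apply Rle_Rpower_l; lra]. }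
  assert (Bdg : forall t, c <= t <= d -> Cmod (dg t * G t) <= K * (2 * Cmod X + 2 * Cmod Y + 8) * M * Rpower t (Re X - 1)).
  { intros t Ht; rewrite Cmod_mult; unfold dg; rewrite Cmod_mult.
    replace (K * (2 * Cmod X + 2 * Cmod Y + 8) * M * Rpower t (Re X - 1)) with
      (K * Rpower t (Re X - 1) * (2 * Cmod X + 2 * Cmod Y + 8) * M) by ring.
    apply Rmult_le_compat; [apply Rmult_le_pos; apply Cmod_ge_0|apply Cmod_ge_0| |apply HM, unit_ratio_pos; lra].
    apply Rmult_le_compat; try apply Cmod_ge_0; auto.
    eapply Rle_trans; [apply Cmod_triangle|].
    apply Rplus_le_compat; [eapply Rle_trans; [apply Cmod_triangle|apply Rplus_le_compat]|].
    - rewrite Cmod_mult, Cmod_R, Rmult_comm; apply Rmult_le_compat_r; [apply Cmod_ge_0|].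
      rewrite Rabs_pos_eq by (apply Rdiv_le_0_compat; lra); apply Rle_div_l; lra.
    - rewrite Cmod_opp, Cmod_mult, Cmod_R, Rmult_comm; apply Rmult_le_compat_r; [apply Cmod_ge_0|].
      rewrite Rabs_pos_eq by (apply Rdiv_le_0_compat; lra); apply Rle_div_l; lra.
    - assert (0 < (1 - 2 * t) ^ 2) by nra.
      rewrite Cmod_R, Rabs_pos_eq by (apply Rdiv_le_0_compat; nra); apply Rle_div_l; nra. }
  assert (I1 : Cmod (RIntC (fun t => dg t * G t)%C c d) <=
     K * (2 * Cmod X + 2 * Cmod Y + 8) * M / Re X * Rpower d (Re X)).
  { apply Cmod_RIntC_power_le; auto.
    generalize (Cmod_ge_0 X) (Cmod_ge_0 Y); intros.
    repeat apply Rmult_le_pos; lra. }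
  rewrite Ek, Cmod_mult, Cmod_R, Rabs_pos_eq by (apply Rlt_le, Rinv_0_lt_compat, Hrho).
  replace (M / rho * tail_const X Y * Rpower d (Re X)) with
    (/ rho * (K * (2 * Cmod X + 2 * Cmod Y + 8) * M / Re X * Rpower d (Re X) +
       (2 * K * M * Rpower d (Re X) + 2 * K * M * Rpower d (Re X)))).
  2: { unfold tail_const; fold K; field; lra. }
  apply Rmult_le_compat_l; [apply Rlt_le, Rinv_0_lt_compat, Hrho|].
  eapply Rle_trans; [apply Cmod_triangle|apply Rplus_le_compat; [exact I1|]].
  rewrite Cmod_opp; eapply Rle_trans; [apply Cmod_triangle|].
  rewrite Cmod_opp; apply Rplus_le_compat; apply Bg; lra.
Qed.

(** * Differentiation under the integral *)

Lemma strip_near (P : R -> R -> Prop) (x t : R) :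
  (forall u v, 0 < u -> 0 < v < 1 -> P u v) -> 0 < x -> 0 < t < 1 -> locally_2d P x t.
Proof.
  intros HP Hx Ht.
  assert (Hm : 0 < Rmin x (Rmin t (1 - t))) by (repeat apply Rmin_pos; lra).
  exists (mkposreal _ Hm); intros u v Hu Hv; simpl in *.
  generalize (Rmin_l x (Rmin t (1 - t))) (Rmin_r x (Rmin t (1 - t)))
    (Rmin_l t (1 - t)) (Rmin_r t (1 - t)); intros.
  apply Rabs_def2 in Hu; apply Rabs_def2 in Hv; apply HP; lra.
Qed.

Lemma half_line_near (P : R -> Prop) (x : R) :
  (forall u, 0 < u -> P u) -> 0 < x -> locally x P.
Proof.
  intros HP Hx; exists (mkposreal x Hx); intros u Hu.
  apply Rabs_def2 in Hu; unfold minus, plus, opp in Hu; simpl in Hu; apply HP; lra.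
Qed.

Lemma is_derive_RInt_strip (f df : R -> R -> R) (a b x : R) :
  (forall u v, 0 < u -> 0 < v < 1 -> is_derive (fun z => f z v) u (df u v)) ->
  (forall u v, 0 < u -> 0 < v < 1 -> continuity_2d_pt df u v) ->
  (forall u, 0 < u -> ex_RInt (f u) a b) ->
  0 < a <= b -> b < 1 -> 0 < x ->
  is_derive (fun u => RInt (f u) a b) x (RInt (df x) a b).
Proof.
  intros Hd Hc Hi Ha Hb Hx.
  evar_last.
  - apply (is_derive_RInt_param f a b x).
    + apply half_line_near; [|exact Hx]; intros u Hu t.
      rewrite Rmin_left, Rmax_right by lra; intros Ht; exists (df u t); apply Hd; lra.
    + intros t; rewrite Rmin_left, Rmax_right by lra; intros Ht.
      apply (continuity_2d_pt_ext_loc df); [|apply Hc; lra].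
      apply strip_near; [|lra|lra].
      intros u v Hu Hv; symmetry; apply is_derive_unique, Hd; assumption.
    + apply half_line_near; assumption.
  - apply (RInt_ext (V := R_CompleteNormedModule)); intros t.
    rewrite Rmin_left, Rmax_right by lra; intros Ht.
    apply is_derive_unique, Hd; lra.
Qed.

(** Uniform continuity along the segment {x} x [a, b] makes |f y t - f x t| at most eps/2 for all t
    once y is near x; then b - a < 1 finishes. *)
Lemma continuous_RInt_strip (f : R -> R -> R) (a b x : R) :
  (forall u v, 0 < u -> 0 < v < 1 -> continuity_2d_pt f u v) ->
  (forall u, 0 < u -> ex_RInt (f u) a b) ->
  0 < a <= b -> b < 1 -> 0 < x ->
  continuous (fun u => RInt (f u) a b) x.
Proof.
  intros Hc Hi Ha Hb Hx.
  apply filterlim_locally; intros eps.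
  destruct (uniform_continuity_2d_1d' f a b x (fun t Ht => Hc x t Hx ltac:(lra))
    (mkposreal _ (is_pos_div_2 eps))) as [delta Hdelta].
  assert (Hm : 0 < Rmin x delta) by (apply Rmin_pos; [lra|apply cond_pos]).
  exists (mkposreal _ Hm); intros y Hy; simpl in *.
  generalize (Rmin_l x delta) (Rmin_r x delta); intros.
  apply Rabs_def2 in Hy; unfold minus, plus, opp in Hy; simpl in Hy.
  change (Rabs (RInt (f y) a b - RInt (f x) a b) < eps).
  assert (Hy0 : 0 < y) by lra.
  apply Rle_lt_trans with ((b - a) * (eps / 2)).
  - apply (norm_RInt_le_const (V := R_NormedModule) (fun t => f y t - f x t) a b); [lra| |].
    + intros t Ht; apply Rlt_le, (Hdelta t x t y); try lra.
      rewrite Rminus_diag, Rabs_R0; apply cond_pos.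
    + apply (is_RInt_minus (V := R_NormedModule)); apply (RInt_correct (V := R_CompleteNormedModule)), Hi; assumption.
  - generalize (cond_pos eps); nra.
Qed.

Lemma Re_RIntC (f : R -> C) (a b : R) : ex_RIntC f a b -> Re (RIntC f a b) = RInt (fun t => Re (f t)) a b.
Proof.
  intros H; symmetry; apply is_RInt_unique.
  apply (is_RInt_fct_extend_fst (U := R_NormedModule) (V := R_NormedModule)).
  apply (RInt_correct (V := C_R_CompleteNormedModule)), H.
Qed.

Lemma Im_RIntC (f : R -> C) (a b : R) : ex_RIntC f a b -> Im (RIntC f a b) = RInt (fun t => Im (f t)) a b.
Proof.
  intros H; symmetry; apply is_RInt_unique.
  apply (is_RInt_fct_extend_snd (U := R_NormedModule) (V := R_NormedModule)).
  apply (RInt_correct (V := C_R_CompleteNormedModule)), H.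
Qed.

Lemma ex_RInt_Re (f : R -> C) (a b : R) : ex_RIntC f a b -> ex_RInt (fun t => Re (f t)) a b.
Proof.
  intros [l H]; exists (Re l); exact (is_RInt_fct_extend_fst (U := R_NormedModule) (V := R_NormedModule) _ _ _ _ H).
Qed.

Lemma ex_RInt_Im (f : R -> C) (a b : R) : ex_RIntC f a b -> ex_RInt (fun t => Im (f t)) a b.
Proof.
  intros [l H]; exists (Im l); exact (is_RInt_fct_extend_snd (U := R_NormedModule) (V := R_NormedModule) _ _ _ _ H).
Qed.

(** The two conclusions together are what the fundamental theorem of calculus in rho asks for: a
    derivative, and its continuity. *)
Lemma is_derive_RIntC_strip (f df : R -> R -> C) (a b x : R) :
  (forall u v, 0 < u -> 0 < v < 1 -> is_derive (V := C_R_NormedModule) (fun z => f z v) u (df u v)) ->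
  (forall u v, 0 < u -> 0 < v < 1 -> continuous (fun z => df (fst z) (snd z)) (u, v)) ->
  (forall u, 0 < u -> ex_RIntC (f u) a b) ->
  (forall u, 0 < u -> ex_RIntC (df u) a b) ->
  0 < a <= b -> b < 1 -> 0 < x ->
  is_derive (V := C_R_NormedModule) (fun u => RIntC (f u) a b) x (RIntC (df x) a b) /\
  continuous (fun u => RIntC (df u) a b) x.
Proof.
  intros Hd Hc Hi Hi' Ha Hb Hx.
  assert (Hcr : forall u v, 0 < u -> 0 < v < 1 -> continuity_2d_pt (fun u v => Re (df u v)) u v).
  { intros u v Hu Hv; apply continuity_2d_pt_filterlim, (continuous_Re _ _ (Hc u v Hu Hv)). }
  assert (Hci : forall u v, 0 < u -> 0 < v < 1 -> continuity_2d_pt (fun u v => Im (df u v)) u v).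
  { intros u v Hu Hv; apply continuity_2d_pt_filterlim, (continuous_Im _ _ (Hc u v Hu Hv)). }
  split.
  - apply is_derive_C_pair.
    + rewrite Re_RIntC by auto.
      apply (is_derive_ext_loc (fun u => RInt (fun t => Re (f u t)) a b)).
      { apply half_line_near; [|exact Hx]; intros u Hu; symmetry; apply Re_RIntC; auto. }
      apply (is_derive_RInt_strip (fun u t => Re (f u t)) (fun u t => Re (df u t))); auto.
      * intros; apply (is_derive_Re (fun z => f z v)); auto.
      * intros; apply ex_RInt_Re; auto.
    + rewrite Im_RIntC by auto.
      apply (is_derive_ext_loc (fun u => RInt (fun t => Im (f u t)) a b)).
      { apply half_line_near; [|exact Hx]; intros u Hu; symmetry; apply Im_RIntC; auto. }
      apply (is_derive_RInt_strip (fun u t => Im (f u t)) (fun u t => Im (df u t))); auto.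
      * intros; apply (is_derive_Im (fun z => f z v)); auto.
      * intros; apply ex_RInt_Im; auto.
  - apply continuous_C_pair.
    + apply (continuous_ext_loc _ (fun u => RInt (fun t => Re (df u t)) a b)).
      { apply half_line_near; [|exact Hx]; intros u Hu; symmetry; apply Re_RIntC; auto. }
      apply (continuous_RInt_strip (fun u t => Re (df u t))); auto.
      intros; apply ex_RInt_Re; auto.
    + apply (continuous_ext_loc _ (fun u => RInt (fun t => Im (df u t)) a b)).
      { apply half_line_near; [|exact Hx]; intros u Hu; symmetry; apply Im_RIntC; auto. }
      apply (continuous_RInt_strip (fun u t => Im (df u t))); auto.
      intros; apply ex_RInt_Im; auto.
Qed.

(* Its [rho]-derivative is [Mellin_kern X Y h rho t] when [H' = h]. *)
Definition Mellin_prim (X Y : C) (H : R -> C) (rho t : R) : C :=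
  (Beta_integrand X Y t * H (rho / (t * (1 - t)))%R)%C.

Lemma continuous_prim (X Y : C) (H : R -> C) (rho t : R) :
  (forall u, 0 < u -> continuous H u) -> 0 < rho -> 0 < t < 1 -> continuous (Mellin_prim X Y H rho) t.
Proof.
  intros HH Hrho Ht; apply continuous_Cmult; [apply continuous_Beta_integrand, Ht|].
  apply (continuous_comp (fun t => rho / (t * (1 - t))) H).
  - apply continuous_unit_ratio, Ht.
  - apply HH, unit_ratio_pos; assumption.
Qed.

(** Fubini on the rectangle [a, b] x [c, d], without a double integral: the t-integral of
    [Mellin_prim] is differentiated under the integral sign and the derivative is integrated back in
    rho. *)
Lemma is_RInt_prim_diff (X Y : C) (h H : R -> C) (a b c d : R) :
  (forall u, 0 < u -> continuous h u) ->
  (forall u, 0 < u -> is_derive (V := C_R_NormedModule) H u (h u)) ->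
  0 < a <= b -> 0 < c <= d -> d < 1 ->
  is_RInt (V := C_R_NormedModule) (fun rho => RIntC (Mellin_kern X Y h rho) c d) a b
    (RIntC (Mellin_prim X Y H b) c d - RIntC (Mellin_prim X Y H a) c d)%C.
Proof.
  intros Hh HH Ha Hc Hd.
  assert (K : forall rho, 0 < rho ->
    is_derive (V := C_R_NormedModule) (fun u => RIntC (Mellin_prim X Y H u) c d) rho (RIntC (Mellin_kern X Y h rho) c d) /\
    continuous (fun u => RIntC (Mellin_kern X Y h u) c d) rho).
  { intros rho Hrho; apply is_derive_RIntC_strip; auto.
    - intros u v Hu Hv.
      evar_last.
      { apply is_derive_Cmult; [apply (is_derive_const (V := C_R_NormedModule))|].
        apply (is_derive_C_comp H (fun z => z / (v * (1 - v))) u (/ (v * (1 - v))));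
          [|apply HH, unit_ratio_pos; assumption].
        generalize (unit_prod_pos v Hv); intros; auto_derive; [trivial|field; lra]. }
      as_C; unfold Mellin_kern; change (@zero C_R_NormedModule) with (RtoC 0); ring.
    - intros u v Hu Hv; unfold Mellin_kern; apply continuous_Cmult; [apply continuous_Cmult|].
      + apply (continuous_comp snd (Beta_integrand X Y)); [apply continuous_snd|].
        apply continuous_Beta_integrand, Hv.
      + apply continuous_RtoC.
        apply (continuous_comp snd (fun t => / (t * (1 - t)))); [apply continuous_snd|].
        apply (ex_derive_continuous (fun t => / (t * (1 - t)))); auto_derive.
        apply Rgt_not_eq, unit_prod_pos, Hv.
      + apply (continuous_comp (fun z : R * R => fst z / (snd z * (1 - snd z))) h).
        * apply (continuous_mult (K := R_AbsRing) fst (fun z : R * R => / (snd z * (1 - snd z)))); [apply continuous_fst|].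
          apply (continuous_comp snd (fun t => / (t * (1 - t)))); [apply continuous_snd|].
          apply (ex_derive_continuous (fun t => / (t * (1 - t)))); auto_derive.
          apply Rgt_not_eq, unit_prod_pos, Hv.
        * apply Hh, unit_ratio_pos; assumption.
    - intros u Hu; apply ex_RIntC_unit; try lra.
      intros t Ht; apply continuous_prim; auto.
      intros w Hw; apply (ex_derive_continuous (V := C_R_NormedModule)); eexists; apply HH, Hw.
    - intros u Hu; apply ex_RIntC_unit; try lra.
      intros t Ht; apply continuous_kern; auto. }
  apply (is_RInt_derive (V := C_R_CompleteNormedModule) (fun u => RIntC (Mellin_prim X Y H u) c d));
    intros rho; rewrite Rmin_left, Rmax_right by lra; intros Hrho; apply K; lra.
Qed.

(** * Exchange of the improper integrals *)

(** The first term bounds the tail of the Beta integrand at 0, the second the tail at 1; their sum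
    serves both ends and is symmetric in X and Y. *)
Definition beta_tail (X Y : C) (d : R) : R :=
  half_bound Y / Re X * Rpower d (Re X) + half_bound X / Re Y * Rpower d (Re Y).

Lemma filterlim_tails (A B e1 e2 : R) : 0 < e1 -> 0 < e2 ->
  filterlim (fun d => A * Rpower d e1 + B * Rpower d e2) (at_right 0) (locally 0).
Proof.
  intros H1 H2.
  replace 0 with (A * 0 + B * 0) at 2 by ring.
  apply (filterlim_comp_2 (G := locally (A * 0)) (H := locally (B * 0)));
    [| |apply (filterlim_plus (V := R_NormedModule))].
  - apply (filterlim_comp _ _ _ (fun d => Rpower d e1) (fun r => A * r) _ (locally 0));
      [apply filterlim_Rpower_0, H1|apply (filterlim_scal_r (V := R_NormedModule) A 0)].
  - apply (filterlim_comp _ _ _ (fun d => Rpower d e2) (fun r => B * r) _ (locally 0));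
      [apply filterlim_Rpower_0, H2|apply (filterlim_scal_r (V := R_NormedModule) B 0)].
Qed.

Lemma tail_left_pos (Y : C) (r e d : R) : 0 < e -> 0 <= half_bound Y / e * Rpower d r.
Proof.
  intros He; apply Rmult_le_pos; [|apply Rlt_le, exp_pos].
  apply Rdiv_le_0_compat; [apply Rlt_le, exp_pos|exact He].
Qed.

Lemma beta_tail_pos (X Y : C) (d : R) : 0 < Re X -> 0 < Re Y -> 0 <= beta_tail X Y d.
Proof. intros HX HY; apply Rplus_le_le_0_compat; apply tail_left_pos; assumption. Qed.

Lemma dominated_left_tail (X Y : C) (f : R -> C) (m c d : R) : 0 < Re X -> 0 < Re Y -> 0 <= m ->
  (forall t, 0 < t < 1 -> continuous f t) -> 0 < c <= d -> d <= 1/2 ->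
  (forall t, c <= t <= d -> Cmod (f t) <= m * Cmod (Beta_integrand X Y t)) ->
  Cmod (RIntC f c d) <= m * beta_tail X Y d.
Proof.
  intros HX HY Hm Hf Hc Hd Hle.
  apply Rle_trans with (m * half_bound Y / Re X * Rpower d (Re X)).
  - apply Cmod_RIntC_power_le; auto.
    + apply Rmult_le_pos; [exact Hm|apply Rlt_le, exp_pos].
    + apply ex_RIntC_unit; auto; lra.
    + intros t Ht; eapply Rle_trans; [apply Hle, Ht|].
      rewrite Rmult_assoc; apply Rmult_le_compat_l; [exact Hm|].
      apply Cmod_Beta_integrand_le; lra.
  - generalize (Rmult_le_pos _ _ Hm (tail_left_pos X (Re Y) (Re Y) d HY)).
    unfold beta_tail, Rdiv; lra.
Qed.

Lemma continuous_reflect (f : R -> C) (t : R) : continuous f (1 - t) -> continuous (fun t => f (1 - t)) t.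
Proof.
  intros Hf; apply (continuous_comp (fun t => 1 - t) f); [|exact Hf].
  apply (ex_derive_continuous (fun t => 1 - t)); auto_derive; trivial.
Qed.

Lemma dominated_right_tail (X Y : C) (f : R -> C) (m c d : R) : 0 < Re X -> 0 < Re Y -> 0 <= m ->
  (forall t, 0 < t < 1 -> continuous f t) -> 0 < c <= d -> d <= 1/2 ->
  (forall t, 1 - d <= t <= 1 - c -> Cmod (f t) <= m * Cmod (Beta_integrand X Y t)) ->
  Cmod (RIntC f (1 - d) (1 - c)) <= m * beta_tail X Y d.
Proof.
  intros HX HY Hm Hf Hc Hd Hle.
  rewrite RIntC_reflect by (apply ex_RIntC_unit; auto; lra).
  replace (beta_tail X Y d) with (beta_tail Y X d) by (unfold beta_tail; ring).
  apply dominated_left_tail; auto.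
  - intros t Ht; apply continuous_reflect, Hf; lra.
  - intros t Ht; rewrite <- Beta_integrand_reflect; apply Hle; lra.
Qed.

(** Each half of (0, 1) is treated as a tail of length 1/2, so [2 * beta_tail X Y (1/2)] stands in
    for the integral of the modulus of the Beta integrand. *)
Lemma dominated_total (X Y : C) (f : R -> C) (m c d : R) : 0 < Re X -> 0 < Re Y -> 0 <= m ->
  (forall t, 0 < t < 1 -> continuous f t) -> 0 < c <= 1/2 -> 1/2 <= d < 1 ->
  (forall t, c <= t <= d -> Cmod (f t) <= m * Cmod (Beta_integrand X Y t)) ->
  Cmod (RIntC f c d) <= m * (2 * beta_tail X Y (1/2)).
Proof.
  intros HX HY Hm Hf Hc Hd Hle.
  rewrite (RIntC_Chasles f c (1/2) d) by (apply ex_RIntC_unit; auto; lra).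
  eapply Rle_trans; [apply Cmod_triangle|].
  replace (m * (2 * beta_tail X Y (1/2))) with (m * beta_tail X Y (1/2) + m * beta_tail X Y (1/2)) by ring.
  apply Rplus_le_compat.
  - apply dominated_left_tail; auto; try lra; intros; apply Hle; lra.
  - replace (1/2) with (1 - 1/2) at 1 by field; replace d with (1 - (1 - d)) by ring.
    apply dominated_right_tail; auto; try lra; intros; apply Hle; lra.
Qed.

(** Applied with m a bound of |H| to obtain J(rho), and with m = 1 to the Beta integrand itself. *)
Lemma is_CInt_dominated (X Y : C) (f : R -> C) (m : R) : 0 < Re X -> 0 < Re Y -> 0 <= m ->
  (forall t, 0 < t < 1 -> continuous f t) ->
  (forall t, 0 < t < 1 -> Cmod (f t) <= m * Cmod (Beta_integrand X Y t)) ->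
  exists I : C, is_CInt f (at_right 0) (at_left 1) I /\
    forall c d, 0 < c <= 1/4 -> 3/4 <= d < 1 ->
      Cmod (RIntC f c d - I) <= m * beta_tail X Y c + m * beta_tail X Y (1 - d).
Proof.
  intros HX HY Hm Hf Hle.
  apply (is_CInt_unit_tails f (fun d => m * beta_tail X Y d)); auto.
  - apply (filterlim_ext (fun d => (m * (half_bound Y / Re X)) * Rpower d (Re X)
      + (m * (half_bound X / Re Y)) * Rpower d (Re Y))).
    + intros d; unfold beta_tail; ring.
    + apply filterlim_tails; assumption.
  - intros c d Hc Hd; apply dominated_left_tail; auto; try lra; intros; apply Hle; lra.
  - intros c d Hc Hd; apply dominated_right_tail; auto; try lra; intros; apply Hle; lra.
Qed.

Definition kern_tail (X Y : C) (d : R) : R :=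
  tail_const X Y * Rpower d (Re X) + tail_const Y X * Rpower d (Re Y).

Lemma tail_const_pos (X Y : C) : 0 < Re X -> 0 <= tail_const X Y.
Proof.
  intros HX; generalize (Cmod_ge_0 X) (Cmod_ge_0 Y); intros.
  apply Rmult_le_pos; [apply Rlt_le, exp_pos|].
  apply Rplus_le_le_0_compat; [lra|apply Rdiv_le_0_compat; lra].
Qed.

(** The error is proportional to M / rho, hence at most its value at rho = a throughout [a, b]: the
    cut-off integrals converge uniformly there. *)
Lemma is_CInt_kern (X Y : C) (h H : R -> C) (M rho : R) :
  0 < Re X -> 0 < Re Y ->
  (forall u, 0 < u -> continuous h u) ->
  (forall u, 0 < u -> is_derive (V := C_R_NormedModule) H u (h u)) ->
  (forall u, 0 < u -> Cmod (H u) <= M) ->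
  0 < rho ->
  exists I : C, is_CInt (Mellin_kern X Y h rho) (at_right 0) (at_left 1) I /\
    forall c d, 0 < c <= 1/4 -> 3/4 <= d < 1 ->
      Cmod (RIntC (Mellin_kern X Y h rho) c d - I) <= M / rho * kern_tail X Y c + M / rho * kern_tail X Y (1 - d).
Proof.
  intros HX HY Hh HH HM Hrho.
  assert (M0 : 0 <= M) by (eapply Rle_trans; [apply Cmod_ge_0|apply (HM 1 Rlt_0_1)]).
  assert (Mr : 0 <= M / rho) by (apply Rdiv_le_0_compat; assumption).
  assert (Hk : forall t, 0 < t < 1 -> continuous (Mellin_kern X Y h rho) t).
  { intros t Ht; apply continuous_kern; auto. }
  assert (Pos : forall A B d r, 0 < Re A -> 0 <= M / rho * tail_const A B * Rpower d r).
  { intros A B d r HA; apply Rmult_le_pos; [apply Rmult_le_pos; [exact Mr|apply tail_const_pos, HA]|apply Rlt_le, exp_pos]. }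
  apply (is_CInt_unit_tails _ (fun d => M / rho * kern_tail X Y d)); auto.
  - apply (filterlim_ext (fun d => (M / rho * tail_const X Y) * Rpower d (Re X)
      + (M / rho * tail_const Y X) * Rpower d (Re Y))).
    + intros d; unfold kern_tail; ring.
    + apply filterlim_tails; assumption.
  - intros c d Hc Hd.
    generalize (Cmod_RIntC_kern_le X Y h H M rho c d HX Hh HH HM Hrho Hc Hd) (Pos Y X d (Re Y) HY).
    unfold kern_tail; lra.
  - intros c d Hc Hd.
    rewrite RIntC_reflect by (apply ex_RIntC_unit; auto; lra).
    rewrite (RInt_ext (V := C_R_CompleteNormedModule) _ (Mellin_kern Y X h rho)).
    2: { intros t _; apply kern_reflect. }
    generalize (Cmod_RIntC_kern_le Y X h H M rho c d HY Hh HH HM Hrho Hc Hd) (Pos X Y d (Re X) HX).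
    unfold kern_tail; lra.
Qed.

Lemma CInt_unique {Fa Fb : (R -> Prop) -> Prop} {FFa : ProperFilter' Fa} {FFb : ProperFilter' Fb}
  (f : R -> C) (l : C) : is_CInt f Fa Fb l -> CInt f Fa Fb = l.
Proof. intros H; exact (is_RInt_gen_unique (V := C_R_CompleteNormedModule) f l H). Qed.

Lemma is_CInt_filterlim {Fa Fb : (R -> Prop) -> Prop} {FFa : Filter Fa} {FFb : Filter Fb}
  (f : R -> C) (l : C) :
  is_CInt f Fa Fb l -> filterlim (fun z => RIntC f (fst z) (snd z)) (filter_prod Fa Fb) (locally l).
Proof.
  intros H P HP; specialize (H P HP); unfold filtermapi in H; unfold filtermap.
  revert H; apply filter_imp; intros [a b] [y [Hy HPy]].
  simpl in *; rewrite (is_RInt_unique (V := C_R_CompleteNormedModule) f a b y Hy); exact HPy.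
Qed.

Lemma filterlim_one_minus_r : filterlim (fun c => 1 - c) (at_right 0) (at_left 1).
Proof.
  intros P [e He]. exists e; intros d Hd Hd1; apply He; [|lra].
  apply Rabs_def2 in Hd; unfold minus, plus, opp in Hd; simpl in Hd.
  apply Rabs_def1; unfold minus, plus, opp; simpl; lra.
Qed.

(** A uniform limit of Riemann integrable functions is integrable with the limiting integral; the
    cut-off integrals in t are such a sequence of functions of rho, and their rho-integrals are
    known exactly. *)
Lemma is_RInt_CInt_kern (X Y : C) (h H : R -> C) (M a b : R) (Ja Jb : C) :
  0 < Re X -> 0 < Re Y ->
  (forall u, 0 < u -> continuous h u) ->
  (forall u, 0 < u -> is_derive (V := C_R_NormedModule) H u (h u)) ->
  (forall u, 0 < u -> Cmod (H u) <= M) ->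
  0 < a <= b ->
  is_CInt (Mellin_prim X Y H a) (at_right 0) (at_left 1) Ja ->
  is_CInt (Mellin_prim X Y H b) (at_right 0) (at_left 1) Jb ->
  is_RInt (V := C_R_NormedModule) (fun rho => CInt (Mellin_kern X Y h rho) (at_right 0) (at_left 1)) a b (Jb - Ja)%C.
Proof.
  intros HX HY Hh HH HM Ha HJa HJb.
  assert (M0 : 0 <= M) by (eapply Rle_trans; [apply Cmod_ge_0|apply (HM 1 Rlt_0_1)]).
  assert (CH : forall u, 0 < u -> continuous H u).
  { intros u Hu; apply (ex_derive_continuous (V := C_R_NormedModule)); eexists; apply HH, Hu. }
  (* The shift by 4 keeps every cut-off at most 1/4, the range of the tail bounds. *)
  set (e := fun n : nat => / (INR n + 4)).
  assert (He : forall n, 0 < e n <= 1/4).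
  { intros n; unfold e; generalize (pos_INR n); intros; split; [apply Rinv_0_lt_compat; lra|].
    replace (1/4) with (/ 4) by field; apply Rinv_le_contravar; lra. }
  assert (Le : filterlim e eventually (at_right 0)).
  { intros P [del Hdel].
    assert (Hl : is_lim_seq e 0).
    { unfold e; apply (is_lim_seq_inv _ p_infty); [|discriminate].
      apply (is_lim_seq_plus _ _ p_infty 4); [apply is_lim_seq_INR|apply is_lim_seq_const|reflexivity]. }
    apply is_lim_seq_spec in Hl.
    unfold filtermap; generalize (Hl del); apply filter_imp; intros n Hn; apply Hdel; [|apply He].
    exact Hn. }
  (* [filterlim_RInt] speaks of uniform convergence on all of R, so the functions of rho are set to
     0 outside [a, b]. *)
  set (on := fun (rho : R) (z : C) => if Rle_dec a rho then if Rle_dec rho b then z else RtoC 0 else RtoC 0).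
  assert (Eon : forall rho z, a <= rho <= b -> on rho z = z).
  { intros rho z Hr; unfold on; destruct (Rle_dec a rho), (Rle_dec rho b); trivial; lra. }
  destruct (filterlim_RInt (V := C_R_CompleteNormedModule)
    (fun n rho => on rho (RIntC (Mellin_kern X Y h rho) (e n) (1 - e n))) a b eventually _
    (fun rho => on rho (CInt (Mellin_kern X Y h rho) (at_right 0) (at_left 1)))
    (fun n => RIntC (Mellin_prim X Y H b) (e n) (1 - e n) - RIntC (Mellin_prim X Y H a) (e n) (1 - e n))%C)
    as [If [L1 L2]].
  { intros n; specialize (He n).
    apply (is_RInt_ext (V := C_R_NormedModule) (fun rho => RIntC (Mellin_kern X Y h rho) (e n) (1 - e n))).
    { intros rho; rewrite Rmin_left, Rmax_right by lra; intros; symmetry; apply Eon; lra. }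
    apply is_RInt_prim_diff; auto; lra. }
  { apply (proj2 (filterlim_locally (U := fct_UniformSpace R C_R_CompleteNormedModule) _ _)); intros eps.
    assert (Lt : filterlim (fun n => kern_tail X Y (e n)) eventually (locally 0)).
    { apply (filterlim_comp _ _ _ e (kern_tail X Y) _ (at_right 0)); [exact Le|].
      apply filterlim_tails; assumption. }
    (* Two tails with factor at most M / a; the added 1 keeps the divisor positive when M = 0. *)
    assert (Hd : 0 < eps / (2 * (M / a) + 1)).
    { assert (0 <= M / a) by (apply Rdiv_le_0_compat; lra).
      apply Rdiv_lt_0_compat; [apply cond_pos|lra]. }
    generalize (proj1 (filterlim_locally _ _) Lt (mkposreal _ Hd)); apply filter_imp; intros n Hn rho.
    apply (norm_compat1 (V := C_R_NormedModule)); rewrite norm_C_R.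
    change (Cmod (on rho (RIntC (Mellin_kern X Y h rho) (e n) (1 - e n)) -
      on rho (CInt (Mellin_kern X Y h rho) (at_right 0) (at_left 1))) < eps).
    specialize (He n).
    assert (Hcase : a <= rho <= b \/ (forall z, on rho z = RtoC 0)).
    { unfold on; destruct (Rle_dec a rho), (Rle_dec rho b); auto. }
    destruct Hcase as [Hr|Hr].
    2: { rewrite !Hr; unfold Cminus; rewrite Cplus_opp_r, Cmod_0; apply cond_pos. }
    rewrite !Eon by assumption.
    destruct (is_CInt_kern X Y h H M rho) as [I [HI HB]]; auto; [lra|].
    rewrite (CInt_unique _ _ HI).
    eapply Rle_lt_trans; [apply HB; lra|].
    replace (1 - (1 - e n)) with (e n) by ring.
    apply Rabs_def2 in Hn; unfold minus, plus, opp in Hn; simpl in Hn.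
    assert (Hk : 0 <= kern_tail X Y (e n)).
    { apply Rplus_le_le_0_compat; apply Rmult_le_pos; try (apply tail_const_pos; assumption); apply Rlt_le, exp_pos. }
    assert (M / rho <= M / a).
    { apply Rmult_le_compat_l; [exact M0|apply Rinv_le_contravar; lra]. }
    assert (0 <= M / a) by (apply Rdiv_le_0_compat; lra).
    apply Rle_lt_trans with (2 * (M / a) * kern_tail X Y (e n)); [nra|].
    apply Rle_lt_trans with ((2 * (M / a) + 1) * kern_tail X Y (e n)); [nra|].
    destruct Hn as [Hn _]; apply Rlt_div_r in Hn; lra. }
  (* The same sequence of rho-integrals also tends to Jb - Ja, because the cut-off integrals of
     [Mellin_prim] converge along (e n, 1 - e n). *)
  assert (EI : If = (Jb - Ja)%C).
  { apply (filterlim_locally_unique (V := C_R_NormedModule) _ _ _ L1).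
    assert (Lp : filterlim (fun n => (e n, 1 - e n)) eventually (filter_prod (at_right 0) (at_left 1))).
    { apply filterlim_pair; [exact Le|].
      apply (filterlim_comp _ _ _ e (fun c => 1 - c) _ (at_right 0)); [exact Le|apply filterlim_one_minus_r]. }
    generalize (filterlim_comp _ _ _ _ _ _ _ _ Lp (is_CInt_filterlim _ _ HJa))
      (filterlim_comp _ _ _ _ _ _ _ _ Lp (is_CInt_filterlim _ _ HJb)); intros La Lb.
    apply (filterlim_Cmod (F := eventually)); intros eps Heps.
    assert (Ea := proj1 (filterlim_Cmod (F := eventually) _ _) La (eps / 2) ltac:(lra)).
    assert (Eb := proj1 (filterlim_Cmod (F := eventually) _ _) Lb (eps / 2) ltac:(lra)).
    generalize (filter_and _ _ Ea Eb); apply filter_imp; intros n [h1 h2]; simpl in h1, h2.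
    replace (_ - _)%C with ((RIntC (Mellin_prim X Y H b) (e n) (1 - e n) - Jb) + - (RIntC (Mellin_prim X Y H a) (e n) (1 - e n) - Ja))%C by ring.
    eapply Rle_lt_trans; [apply Cmod_triangle|]; rewrite Cmod_opp; lra. }
  rewrite <- EI.
  revert L2; apply (is_RInt_ext (V := C_R_NormedModule)).
  intros rho; rewrite Rmin_left, Rmax_right by lra; intros; apply Eon; lra.
Qed.

(** * Endpoint limits *)

Lemma Cmod_CInt_unit_le (f : R -> C) (I : C) (eta B : R) : 0 < eta <= 1/2 ->
  is_CInt f (at_right 0) (at_left 1) I ->
  (forall c d, 0 < c < eta -> 1 - eta < d < 1 -> Cmod (RIntC f c d) <= B) -> Cmod I <= B.
Proof.
  intros He HI HB; apply le_epsilon; intros eps Heps.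
  assert (HL := proj1 (filterlim_Cmod _ _) (is_CInt_filterlim _ _ HI) eps Heps).
  assert (Hout : filter_prod (at_right 0) (at_left 1) (fun z => 0 < fst z < eta /\ 1 - eta < snd z < 1)).
  { refine (Filter_prod _ _ _ _ _ (at_right_interval 0 eta _) (at_left_interval (1 - eta) 1 _)
          (fun x y a b => conj a b)); lra. }
  destruct (filter_ex _ (filter_and _ _ HL Hout)) as [[c d] [H1 [H2 H3]]]; simpl in *.
  generalize (HB c d H2 H3) (Cmod_sub_triangle I (RIntC f c d) 0).
  unfold Cminus at 1 3; rewrite Copp_0, !Cplus_0_r, (Cmod_sub_sym I); lra.
Qed.

Lemma Cmod_prim_le (X Y : C) (H : R -> C) (m rho t : R) :
  Cmod (H (rho / (t * (1 - t)))) <= m -> Cmod (Mellin_prim X Y H rho t) <= m * Cmod (Beta_integrand X Y t).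
Proof.
  intros HM; unfold Mellin_prim; rewrite Cmod_mult, Rmult_comm.
  apply Rmult_le_compat_r; [apply Cmod_ge_0|exact HM].
Qed.

Lemma is_CInt_prim (X Y : C) (H : R -> C) (M rho : R) : 0 < Re X -> 0 < Re Y ->
  (forall u, 0 < u -> continuous H u) -> (forall u, 0 < u -> Cmod (H u) <= M) -> 0 < rho ->
  exists J : C, is_CInt (Mellin_prim X Y H rho) (at_right 0) (at_left 1) J.
Proof.
  intros HX HY HH HM Hrho.
  assert (M0 : 0 <= M) by (eapply Rle_trans; [apply Cmod_ge_0|apply (HM 1 Rlt_0_1)]).
  destruct (is_CInt_dominated X Y (Mellin_prim X Y H rho) M) as [J [HJ _]]; auto.
  - intros t Ht; apply continuous_prim; auto.
  - intros t Ht; apply Cmod_prim_le, HM, unit_ratio_pos; assumption.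
  - exists J; exact HJ.
Qed.

Lemma unit_prod_ge (eta t : R) : 0 < eta <= 1/2 -> eta <= t <= 1 - eta -> eta * (1 - eta) <= t * (1 - t).
Proof. intros He Ht; nra. Qed.

(** H(rho/w) tends to 0 for each t but not uniformly, as w is small near the endpoints. On
    [eta, 1 - eta] one has w >= eta (1 - eta), so rho/w is small there; outside, |H| <= M is
    multiplied by a small tail of the Beta integrand. *)
Lemma prim_CInt_small_left (X Y : C) (H : R -> C) (M : R) : 0 < Re X -> 0 < Re Y ->
  (forall u, 0 < u -> continuous H u) -> (forall u, 0 < u -> Cmod (H u) <= M) ->
  filterlim H (at_right 0) (locally (RtoC 0)) ->
  forall eps, 0 < eps -> at_right 0 (fun rho => forall J,
    is_CInt (Mellin_prim X Y H rho) (at_right 0) (at_left 1) J -> Cmod J <= eps).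
Proof.
  intros HX HY HH HM HL eps Heps.
  assert (M0 : 0 <= M) by (eapply Rle_trans; [apply Cmod_ge_0|apply (HM 1 Rlt_0_1)]).
  (* Fixes eta: the two outer pieces, each at most M times [beta_tail], together stay below
     eps/2. *)
  assert (Lt : at_right 0 (fun d => (2 * M + 1) * beta_tail X Y d < eps / 2)).
  { assert (L := filterlim_tails ((2 * M + 1) * (half_bound Y / Re X)) ((2 * M + 1) * (half_bound X / Re Y)) _ _ HX HY).
    assert (He2 : 0 < eps / 2) by lra.
    generalize (proj1 (filterlim_locally _ _) L (mkposreal _ He2)); apply filter_imp; intros d Hd.
    apply Rabs_def2 in Hd; unfold minus, plus, opp in Hd; simpl in Hd; unfold beta_tail; lra. }
  destruct (filter_ex (F := at_right 0) _ (filter_and _ _ Lt (at_right_interval 0 (1/4) ltac:(lra))))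
    as [eta [Ht He]].
  assert (Hb : 0 <= beta_tail X Y eta) by (apply beta_tail_pos; assumption).
  set (N := 2 * beta_tail X Y (1/2)).
  assert (HN : 0 <= N) by (generalize (beta_tail_pos X Y (1/2) HX HY); unfold N; lra).
  (* The middle piece is at most m N <= eps/2; the added 1 keeps the divisor positive. *)
  set (m := eps / 2 / (N + 1)).
  assert (Hm : 0 < m) by (apply Rdiv_lt_0_compat; lra).
  destruct (proj1 (filterlim_Cmod _ _) HL m Hm) as [del Hdel].
  assert (Hw : 0 < eta * (1 - eta)) by (apply unit_prod_pos; lra).
  apply (filter_imp (fun rho => 0 < rho < del * (eta * (1 - eta)))).
  2: { apply at_right_interval, Rmult_lt_0_compat; [apply cond_pos|exact Hw]. }
  intros rho Hrho J HJ.
  assert (Hp : forall t, 0 < t < 1 -> continuous (Mellin_prim X Y H rho) t).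
  { intros t Ht'; apply continuous_prim; auto; lra. }
  assert (HG : forall t, 0 < t < 1 -> Cmod (Mellin_prim X Y H rho t) <= M * Cmod (Beta_integrand X Y t)).
  { intros t Ht'; apply Cmod_prim_le, HM, unit_ratio_pos; lra. }
  apply (Cmod_CInt_unit_le (Mellin_prim X Y H rho) J eta); [lra|exact HJ|]; intros c d Hc Hd.
  rewrite (RIntC_Chasles _ c eta d), (RIntC_Chasles _ eta (1 - eta) d) by (apply ex_RIntC_unit; auto; lra).
  assert (B1 : Cmod (RIntC (Mellin_prim X Y H rho) c eta) <= M * beta_tail X Y eta).
  { apply dominated_left_tail; auto; try lra; intros; apply HG; lra. }
  assert (B3 : Cmod (RIntC (Mellin_prim X Y H rho) (1 - eta) d) <= M * beta_tail X Y eta).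
  { replace d with (1 - (1 - d)) by ring.
    apply dominated_right_tail; auto; try lra; intros; apply HG; lra. }
  assert (B2 : Cmod (RIntC (Mellin_prim X Y H rho) eta (1 - eta)) <= m * N).
  { apply dominated_total; auto; try lra.
    intros t Ht'; apply Cmod_prim_le.
    assert (Hr : 0 < rho / (t * (1 - t))) by (apply unit_ratio_pos; lra).
    replace (H (rho / (t * (1 - t)))) with (H (rho / (t * (1 - t)))%R - RtoC 0)%C by ring.
    apply Rlt_le, Hdel; [|exact Hr].
    apply Rabs_def1; unfold minus, plus, opp; simpl; [|generalize (cond_pos del); lra].
    generalize (unit_prod_ge eta t); intros Hge.
    assert (rho / (t * (1 - t)) < del); [|lra].
    apply Rlt_div_l; [apply unit_prod_pos; lra|].
    eapply Rlt_le_trans; [apply Hrho|].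
    apply Rmult_le_compat_l; [apply Rlt_le, cond_pos|lra]. }
  assert (m * N <= eps / 2).
  { unfold m; replace (eps / 2 / (N + 1) * N) with (eps / 2 * (N / (N + 1))) by (field; lra).
    rewrite <- (Rmult_1_r (eps / 2)) at 2; apply Rmult_le_compat_l; [lra|].
    apply Rle_div_l; lra. }
  eapply Rle_trans; [apply Cmod_triangle|].
  generalize (Cmod_triangle (RIntC (Mellin_prim X Y H rho) eta (1 - eta)) (RIntC (Mellin_prim X Y H rho) (1 - eta) d)).
  nra.
Qed.

(** Since 0 < w < 1, rho/w exceeds rho for every t, so the smallness of H at infinity is uniform in
    t and no endpoint has to be cut away. *)
Lemma prim_CInt_small_right (X Y : C) (H : R -> C) : 0 < Re X -> 0 < Re Y ->
  (forall u, 0 < u -> continuous H u) ->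
  filterlim H (Rbar_locally p_infty) (locally (RtoC 0)) ->
  forall eps, 0 < eps -> Rbar_locally p_infty (fun rho => forall J,
    is_CInt (Mellin_prim X Y H rho) (at_right 0) (at_left 1) J -> Cmod J <= eps).
Proof.
  intros HX HY HH HL eps Heps.
  set (N := 2 * beta_tail X Y (1/2)).
  assert (HN : 0 <= N) by (generalize (beta_tail_pos X Y (1/2) HX HY); unfold N; lra).
  set (m := eps / (N + 1)).
  assert (Hm : 0 < m) by (apply Rdiv_lt_0_compat; lra).
  destruct (proj1 (filterlim_Cmod _ _) HL m Hm) as [A HA].
  exists (Rmax A 0); intros rho Hrho J HJ.
  generalize (Rmax_l A 0) (Rmax_r A 0); intros.
  apply Rle_trans with (m * N).
  2: { unfold m; replace (eps / (N + 1) * N) with (eps * (N / (N + 1))) by (field; lra).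
       rewrite <- (Rmult_1_r eps) at 2; apply Rmult_le_compat_l; [lra|].
       apply Rle_div_l; lra. }
  apply (Cmod_CInt_unit_le (Mellin_prim X Y H rho) J (1/2)); [lra|exact HJ|]; intros c d Hc Hd.
  apply dominated_total; auto; try lra.
  { intros t Ht'; apply continuous_prim; auto; lra. }
  intros t Ht; apply Cmod_prim_le.
  replace (H (rho / (t * (1 - t)))) with (H (rho / (t * (1 - t)))%R - RtoC 0)%C by ring.
  apply Rlt_le, HA.
  assert (0 < t * (1 - t)) by (apply unit_prod_pos; lra).
  assert (rho < rho / (t * (1 - t))) by (apply Rlt_div_r; nra).
  lra.
Qed.

(** * The Mellin integral for a general h *)

Lemma is_CInt_Cmult_l {Fa Fb : (R -> Prop) -> Prop} {FFa : Filter Fa} {FFb : Filter Fb}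
  (c : C) (f : R -> C) (l : C) :
  is_CInt f Fa Fb l -> is_CInt (fun t => c * f t)%C Fa Fb (c * l)%C.
Proof.
  intros H P HP.
  assert (HQ : locally l (fun z => P (c * z)%C)).
  { apply (continuous_Cmult (fun _ => c) (fun z => z) l); [apply continuous_const|apply continuous_id|exact HP]. }
  specialize (H _ HQ); unfold filtermapi in *; revert H; apply filter_imp.
  intros [a b] [y [Hy HPy]]; exists (c * y)%C; split; [apply is_RInt_Cmult_l; exact Hy|exact HPy].
Qed.

(** Turns the limit of J at infinity into the vanishing case: J(rho) - B L is the integral built on
    H - L, which tends to 0. *)
Lemma is_CInt_prim_shift (X Y : C) (H : R -> C) (L B J : C) (rho : R) :
  is_CInt (Beta_integrand X Y) (at_right 0) (at_left 1) B ->
  is_CInt (Mellin_prim X Y H rho) (at_right 0) (at_left 1) J ->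
  is_CInt (Mellin_prim X Y (fun u => H u - L)%C rho) (at_right 0) (at_left 1) (J - B * L)%C.
Proof.
  intros HB HJ.
  assert (HBL : is_CInt (fun t => L * Beta_integrand X Y t)%C (at_right 0) (at_left 1) (L * B)%C).
  { apply (is_CInt_Cmult_l L _ B HB). }
  rewrite (Cmult_comm B L).
  refine (is_RInt_gen_ext (V := C_R_NormedModule) _ _ _ _ (is_RInt_gen_minus (V := C_R_NormedModule) _ _ _ _ HJ HBL)).
  apply filter_forall; intros z t _; as_C; unfold Mellin_prim, minus, plus, opp; simpl.
  change (Beta_integrand X Y t * H (rho / (t * (1 - t)))%R - L * Beta_integrand X Y t =
    Beta_integrand X Y t * (H (rho / (t * (1 - t)))%R - L))%C; ring.
Qed.

Lemma is_CInt_Mellin (X Y : C) (h H : R -> C) (M : R) (L B : C) :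
  0 < Re X -> 0 < Re Y ->
  (forall u, 0 < u -> continuous h u) ->
  (forall u, 0 < u -> is_derive (V := C_R_NormedModule) H u (h u)) ->
  (forall u, 0 < u -> Cmod (H u) <= M) ->
  filterlim H (at_right 0) (locally (RtoC 0)) ->
  filterlim H (Rbar_locally p_infty) (locally L) ->
  is_CInt (Beta_integrand X Y) (at_right 0) (at_left 1) B ->
  is_CInt (fun rho => CInt (Mellin_kern X Y h rho) (at_right 0) (at_left 1))
    (at_right 0) (Rbar_locally p_infty) (B * L)%C.
Proof.
  intros HX HY Hh HH HM H0 Hoo HB.
  assert (CH : forall u, 0 < u -> continuous H u).
  { intros u Hu; apply (ex_derive_continuous (V := C_R_NormedModule)); eexists; apply HH, Hu. }
  set (J := fun rho => CInt (Mellin_prim X Y H rho) (at_right 0) (at_left 1)).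
  assert (HJ : forall rho, 0 < rho -> is_CInt (Mellin_prim X Y H rho) (at_right 0) (at_left 1) (J rho)).
  { intros rho Hrho; destruct (is_CInt_prim X Y H M rho) as [j Hj]; auto.
    unfold J; rewrite (CInt_unique _ _ Hj); exact Hj. }
  assert (Pos : filter_prod (at_right 0) (Rbar_locally p_infty) (fun z => 0 < fst z <= snd z)).
  { apply Filter_prod with (fun a => 0 < a < 1) (fun b => 1 < b);
      [apply at_right_interval; lra|exists 1; trivial|simpl; intros; lra]. }
  apply (filterlimi_lim_ext_loc (fun z => J (snd z) - J (fst z))%C).
  { revert Pos; apply filter_imp; intros [a b]; simpl; intros Hab.
    apply (is_RInt_CInt_kern X Y h H M); auto; apply HJ; lra. }
  apply filterlim_Cmod; intros eps Heps.
  (* The endpoint lemmas give non-strict bounds; thirds leave room for the strict inequality. *)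
  assert (E0 := prim_CInt_small_left X Y H M HX HY CH HM H0 (eps / 3) ltac:(lra)).
  assert (E1 : Rbar_locally p_infty (fun rho => 0 < rho /\ Cmod (J rho - B * L) <= eps / 3)).
  { assert (HoL : filterlim (fun u => H u - L)%C (Rbar_locally p_infty) (locally (RtoC 0))).
    { apply filterlim_Cmod; intros e He.
      generalize (proj1 (filterlim_Cmod _ _) Hoo e He); apply filter_imp; intros u Hu.
      replace (_ - _ - _)%C with (H u - L)%C by ring; exact Hu. }
    assert (HP : Rbar_locally p_infty (fun b => 0 < b)) by (exists 0; trivial).
    assert (E := prim_CInt_small_right X Y (fun u => H u - L)%C HX HY
      (fun u Hu => continuous_minus (V := C_R_NormedModule) H (fun _ => L) u (CH u Hu) (continuous_const _ _)) HoL (eps / 3) ltac:(lra)).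
    generalize (filter_and _ _ HP E); apply filter_imp; intros rho [Hrho HE]; split; [exact Hrho|].
    apply HE, is_CInt_prim_shift; auto. }
  apply Filter_prod with (fun a => 0 < a < 1 /\ Cmod (J a) <= eps / 3)
     (fun rho => 0 < rho /\ Cmod (J rho - B * L) <= eps / 3); [|exact E1|].
  - generalize (filter_and _ _ (at_right_interval 0 1 Rlt_0_1) E0); apply filter_imp; intros a [Ha HE].
    split; [exact Ha|apply HE, HJ; lra].
  - simpl; intros a b [Ha Ea] [Hb Eb].
    replace (_ - _)%C with ((J b - B * L) + - J a)%C by ring.
    eapply Rle_lt_trans; [apply Cmod_triangle|]; rewrite Cmod_opp; lra.
Qed.

(** * The M-series *)

Lemma ex_RIntC_half_line (h : R -> C) (a b : R) :
  (forall u, 0 < u -> continuous h u) -> 0 < a -> 0 < b -> ex_RIntC h a b.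
Proof.
  intros Hh Ha Hb; apply (ex_RInt_continuous (V := C_R_CompleteNormedModule)); intros z Hz; apply Hh.
  revert Hz; apply Rmin_case; lra.
Qed.

(** The limits bound H near 0 and near infinity, continuity bounds it on the compact interval
    between; cutting at del/2 rather than del makes the ranges cover the half-line. *)
Lemma bounded_half_line (H : R -> C) (L : C) :
  (forall u, 0 < u -> continuous H u) ->
  filterlim H (at_right 0) (locally (RtoC 0)) ->
  filterlim H (Rbar_locally p_infty) (locally L) ->
  exists M, forall u, 0 < u -> Cmod (H u) <= M.
Proof.
  intros HH H0 Hoo.
  destruct (proj1 (filterlim_Cmod _ _) H0 1 Rlt_0_1) as [del Hdel].
  destruct (proj1 (filterlim_Cmod _ _) Hoo 1 Rlt_0_1) as [A HA].
  destruct (bounded_continuity (V := C_R_NormedModule) H (del / 2) A) as [M HM].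
  { intros u Hu; apply HH; generalize (cond_pos del); lra. }
  exists (Rmax (Cmod L + 1) M); intros u Hu.
  generalize (Rmax_l (Cmod L + 1) M) (Rmax_r (Cmod L + 1) M) (Cmod_ge_0 L); intros.
  destruct (Rlt_dec u (del / 2)) as [h1|h1].
  { assert (Hb : Cmod (H u - RtoC 0) < 1).
    { apply Hdel; [|exact Hu]; apply Rabs_def1; unfold minus, plus, opp; simpl; generalize (cond_pos del); lra. }
    replace (H u) with (H u - RtoC 0)%C by ring; lra. }
  destruct (Rlt_dec A u) as [h2|h2].
  { generalize (HA u h2) (Cmod_triangle (H u - L) L); replace (H u - L + L)%C with (H u) by ring; lra. }
  generalize (HM u ltac:(lra)); rewrite norm_C_R; lra.
Qed.

(** The primitive is based at 1, because h may be singular at 0, and then shifted by its limit at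
    0. *)
Lemma primitive_of_improper (h : R -> C) (L : C) :
  (forall u, 0 < u -> continuous h u) ->
  is_CInt h (at_right 0) (Rbar_locally p_infty) L ->
  exists H : R -> C,
    (forall u, 0 < u -> is_derive (V := C_R_NormedModule) H u (h u)) /\
    filterlim H (at_right 0) (locally (RtoC 0)) /\
    filterlim H (Rbar_locally p_infty) (locally L).
Proof.
  intros Hh HL.
  set (P := fun u => RIntC h 1 u).
  assert (EP : forall a b, 0 < a -> 0 < b -> RIntC h a b = (P b - P a)%C).
  { intros a b Ha Hb; unfold P; rewrite (RIntC_Chasles h 1 a b) by (apply ex_RIntC_half_line; auto; lra); symmetry; as_C; ring. }
  assert (DP : forall u, 0 < u -> is_derive (V := C_R_NormedModule) P u (h u)).
  { intros u Hu; apply (is_derive_RInt (V := C_R_NormedModule) h P 1); [|apply Hh, Hu].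
    apply half_line_near; [|exact Hu]; intros v Hv.
    apply (RInt_correct (V := C_R_CompleteNormedModule)), ex_RIntC_half_line; auto; lra. }
  assert (HP : forall eps, 0 < eps -> exists Q1 Q2, at_right 0 Q1 /\ Rbar_locally p_infty Q2 /\
     forall a b, Q1 a -> Q2 b -> 0 < a /\ 0 < b /\ Cmod (P b - P a - L) < eps).
  { intros eps Heps.
    destruct (proj1 (filterlim_Cmod _ _) (is_CInt_filterlim _ _ HL) eps Heps) as [Q1 Q2 h1 h2 hQ].
    exists (fun a => 0 < a < 1 /\ Q1 a), (fun b => 0 < b /\ Q2 b); split; [|split].
    - apply filter_and; [apply at_right_interval; lra|exact h1].
    - apply filter_and; [exists 0; trivial|exact h2].
    - intros a b [Ha Qa] [Hb Qb]; generalize (hQ a b Qa Qb); simpl.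
      rewrite EP by lra; intros; repeat split; lra. }
  (* Convergence is known only jointly in both endpoints. Comparing two lower endpoints against one
     fixed upper endpoint isolates the Cauchy property at 0. *)
  destruct (filterlim_C_cauchy (F := at_right 0) P) as [P0 HP0].
  { intros eps Heps; destruct (HP (eps / 2)) as (Q1 & Q2 & h1 & h2 & hQ); [lra|].
    destruct (filter_ex (F := Rbar_locally p_infty) _ h2) as [b Hb].
    exists Q1; split; [exact h1|]; intros u v Hu Hv.
    generalize (hQ u b Hu Hb) (hQ v b Hv Hb); intros (_ & _ & B1) (_ & _ & B2).
    replace (P u - P v)%C with (- (P b - P u - L) + (P b - P v - L))%C by ring.
    eapply Rle_lt_trans; [apply Cmod_triangle|]; rewrite Cmod_opp; lra. }
  exists (fun u => P u - P0)%C; split; [|split].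
  - intros u Hu; evar_last.
    { apply (is_derive_minus (V := C_R_NormedModule)); [apply DP, Hu|apply (is_derive_const (V := C_R_NormedModule))]. }
    as_C; change (h u - RtoC 0 = h u)%C; ring.
  - apply filterlim_Cmod; intros eps Heps.
    generalize (proj1 (filterlim_Cmod _ _) HP0 eps Heps); apply filter_imp; intros u Hu.
    replace (_ - _ - _)%C with (P u - P0)%C by ring; exact Hu.
  - apply filterlim_Cmod; intros eps Heps.
    destruct (HP (eps / 2)) as (Q1 & Q2 & h1 & h2 & hQ); [lra|].
    assert (h3 := proj1 (filterlim_Cmod _ _) HP0 (eps / 2) ltac:(lra)).
    destruct (filter_ex (F := at_right 0) _ (filter_and _ _ h1 h3)) as [a [Ha Ha']].
    revert h2; apply filter_imp; intros b Hb.
    generalize (hQ a b Ha Hb); intros (_ & _ & B1).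
    replace (_ - _ - _)%C with ((P b - P a - L) + (P a - P0))%C by ring.
    eapply Rle_lt_trans; [apply Cmod_triangle|]; lra.
Qed.

Lemma sum_n_Re (a : nat -> C) (n : nat) :
  Re (sum_n (G := C_AbelianMonoid) a n) = sum_n (fun k => Re (a k)) n.
Proof.
  induction n as [|n IH]; [rewrite !sum_O; reflexivity|].
  rewrite !sum_Sn, <- IH; reflexivity.
Qed.

Lemma sum_n_Im (a : nat -> C) (n : nat) :
  Im (sum_n (G := C_AbelianMonoid) a n) = sum_n (fun k => Im (a k)) n.
Proof.
  induction n as [|n IH]; [rewrite !sum_O; reflexivity|].
  rewrite !sum_Sn, <- IH; reflexivity.
Qed.

Lemma is_series_Re (a : nat -> C) (l : C) :
  is_series (V := C_CompleteNormedModule) a l -> is_series (fun k => Re (a k)) (Re l).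
Proof.
  intros H.
  apply (filterlim_ext (fun n => Re (sum_n (G := C_AbelianMonoid) a n))); [apply sum_n_Re|].
  apply (filterlim_comp _ _ _ _ (fun z : C => Re z) _ _ _ H).
  apply (continuous_Re (fun z => z) l), continuous_id.
Qed.

Lemma is_series_Im (a : nat -> C) (l : C) :
  is_series (V := C_CompleteNormedModule) a l -> is_series (fun k => Im (a k)) (Im l).
Proof.
  intros H.
  apply (filterlim_ext (fun n => Im (sum_n (G := C_AbelianMonoid) a n))); [apply sum_n_Im|].
  apply (filterlim_comp _ _ _ _ (fun z : C => Im z) _ _ _ H).
  apply (continuous_Im (fun z => z) l), continuous_id.
Qed.

Lemma Cseries_unique (a : nat -> C) (l : C) :
  is_series (V := C_CompleteNormedModule) a l -> Cseries a = l.
Proof.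
  intros H; apply (iota_unique (V := C_CompleteNormedModule)); [|exact H].
  intros y Hy; apply (filterlim_locally_unique (V := C_CompleteNormedModule) _ _ _ Hy H).
Qed.

(** If the radius were at most |x|, the point -(|x| + 1) would lie outside the closed disk, where
    the terms cannot tend to 0; but the series converges there. *)
Lemma CV_radius_half_line (a : nat -> R) :
  (forall t, 0 < t -> ex_pseries a (- t)) -> forall x, Rbar_lt (Finite (Rabs x)) (CV_radius a).
Proof.
  intros Ha x; destruct (Rbar_lt_dec (Finite (Rabs x)) (CV_radius a)) as [h|h]; [exact h|exfalso].
  assert (Hx : 0 < Rabs x + 1) by (generalize (Rabs_pos x); lra).
  apply (CV_disk_outside a (- (Rabs x + 1))).
  - rewrite Rabs_Ropp, (Rabs_pos_eq (Rabs x + 1)) by lra.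
    eapply Rbar_le_lt_trans; [apply Rbar_not_lt_le, h|simpl; lra].
  - apply ex_series_lim_0.
    apply (ex_series_ext (fun k => scal (pow_n (- (Rabs x + 1)) k) (a k))); [|apply (Ha _ Hx)].
    intros n; rewrite pow_n_pow; apply Rmult_comm.
Qed.

(** The real and imaginary parts of the coefficients give two real power series of infinite radius,
    each continuous on R. *)
Lemma continuous_Cseries_neg (a : nat -> C) :
  (forall t, 0 < t -> ex_Cseries (fun m => a m * RtoC ((- t) ^ m))%C) ->
  forall u, 0 < u -> continuous (fun t => Cseries (fun m => a m * RtoC ((- t) ^ m))%C) u.
Proof.
  intros Ha u Hu.
  set (b := fun m => Re (a m)); set (c := fun m => Im (a m)).
  assert (Eb : forall t m, Re (a m * RtoC ((- t) ^ m)) = scal (pow_n (K := R_AbsRing) (- t) m) (b m)).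
  { intros t m; replace (pow_n (K := R_AbsRing) (- t) m) with ((- t) ^ m) by (symmetry; apply pow_n_pow); unfold b, scal; simpl; unfold mult, Re; simpl; ring. }
  assert (Ec : forall t m, Im (a m * RtoC ((- t) ^ m)) = scal (pow_n (K := R_AbsRing) (- t) m) (c m)).
  { intros t m; replace (pow_n (K := R_AbsRing) (- t) m) with ((- t) ^ m) by (symmetry; apply pow_n_pow); unfold c, scal; simpl; unfold mult, Im; simpl; ring. }
  assert (Sb : forall t l, is_series (V := C_CompleteNormedModule) (fun m => a m * RtoC ((- t) ^ m))%C l ->
     is_pseries b (- t) (Re l)).
  { intros t l Hl; apply (is_series_ext (fun m => Re (a m * RtoC ((- t) ^ m)))); [apply Eb|].
    apply (is_series_Re _ l Hl). }
  assert (Sc : forall t l, is_series (V := C_CompleteNormedModule) (fun m => a m * RtoC ((- t) ^ m))%C l ->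
     is_pseries c (- t) (Im l)).
  { intros t l Hl; apply (is_series_ext (fun m => Im (a m * RtoC ((- t) ^ m)))); [apply Ec|].
    apply (is_series_Im _ l Hl). }
  assert (Rb : forall x, Rbar_lt (Finite (Rabs x)) (CV_radius b)).
  { apply CV_radius_half_line; intros t Ht; destruct (Ha t Ht) as [l Hl]; exists (Re l); apply Sb, Hl. }
  assert (Rc : forall x, Rbar_lt (Finite (Rabs x)) (CV_radius c)).
  { apply CV_radius_half_line; intros t Ht; destruct (Ha t Ht) as [l Hl]; exists (Im l); apply Sc, Hl. }
  apply (continuous_ext_loc _ (fun t => (PSeries b (- t), PSeries c (- t)))).
  { apply half_line_near; [|exact Hu]; intros t Ht; destruct (Ha t Ht) as [l Hl].
    rewrite (Cseries_unique _ _ Hl), (is_pseries_unique _ _ _ (Sb t l Hl)), (is_pseries_unique _ _ _ (Sc t l Hl)).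
    destruct l; reflexivity. }
  assert (Hop : continuous (fun t : R => - t) u) by (apply (continuous_opp (V := R_NormedModule)), continuous_id).
  apply continuous_C_pair; simpl.
  - apply (continuous_comp (fun t => - t) (PSeries b) u Hop), continuity_pt_filterlim, PSeries_continuity, Rb.
  - apply (continuous_comp (fun t => - t) (PSeries c) u Hop), continuity_pt_filterlim, PSeries_continuity, Rc.
Qed.

Lemma continuous_M_series_neg (kappa mu : list C) (alpha beta : C) :
  (forall t : R, 0 < t -> ex_Cseries (M_term kappa mu alpha beta (RtoC (- t)))) ->
  forall u, 0 < u -> continuous (fun t => M_series kappa mu alpha beta (RtoC (- t))) u.
Proof.
  intros Hs u Hu.
  set (a := fun m => (Pochhammer_prod kappa m / Pochhammer_prod mu m / Gamma (alpha * RtoC (INR m) + beta))%C).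
  assert (E : forall t m, M_term kappa mu alpha beta (RtoC (- t)) m = (a m * RtoC ((- t) ^ m))%C).
  { intros t m; unfold M_term, a; rewrite RtoC_pow; unfold Cdiv; ring. }
  assert (Es : forall t l, is_series (V := C_CompleteNormedModule) (M_term kappa mu alpha beta (RtoC (- t))) l ->
    is_series (V := C_CompleteNormedModule) (fun m => a m * RtoC ((- t) ^ m))%C l).
  { intros t l; apply (is_series_ext (V := C_CompleteNormedModule)); intros m; apply E. }
  apply (continuous_ext_loc _ (fun t => Cseries (fun m => a m * RtoC ((- t) ^ m))%C)).
  - apply half_line_near; [|exact Hu]; intros t Ht; destruct (Hs t Ht) as [l Hl].
    unfold M_series; rewrite (Cseries_unique _ _ Hl); apply Cseries_unique, Es, Hl.
  - apply continuous_Cseries_neg; [|exact Hu]; intros t Ht; destruct (Hs t Ht) as [l Hl].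
    exists l; apply Es, Hl.
Qed.

(** * Identification with the M-beta integral *)

Lemma Rcpow_inv (t : R) (z : C) : 0 < t -> (Rcpow t z * Rcpow (/ t) z)%C = 1%C.
Proof.
  intros Ht; rewrite <- Rcpow_mult by (try apply Rinv_0_lt_compat; assumption).
  rewrite Rinv_r by lra; unfold Rcpow, Cexp; rewrite ln_1, Cmult_0_r; simpl.
  rewrite exp_0, cos_0, sin_0, Rmult_1_l, Rmult_1_l; reflexivity.
Qed.

(** The shift by s in both Beta exponents supplies w^s, with w = t (1 - t). It cancels against the
    factor 1/w of the kernel and the (1/w)^(s-1) split off from (rho/w)^(s-1). *)
Lemma kern_M_beta_integrand (kappa mu : list C) (alpha beta x y s : C) (rho t : R) :
  0 < rho -> 0 < t < 1 ->
  Mellin_kern (x + s) (y + s) (fun u => Rcpow u (s - 1) * M_series kappa mu alpha beta (RtoC (- u)))%C rho t =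
  (Rcpow rho (s - 1) * M_beta_integrand kappa mu alpha beta x y (RtoC rho) t)%C.
Proof.
  intros Hrho Ht; assert (Hw := unit_prod_pos t Ht).
  assert (Hi : 0 < / (t * (1 - t))) by (apply Rinv_0_lt_compat, Hw).
  unfold Mellin_kern, M_beta_integrand, Beta_integrand.
  replace (- RtoC rho / RtoC (t * (1 - t)))%C with (RtoC (- (rho / (t * (1 - t))))).
  2: { unfold Rdiv, Cdiv; rewrite RtoC_opp, RtoC_mult, RtoC_inv by lra; ring. }
  replace (x + s - 1)%C with ((x - 1) + s)%C by ring.
  replace (y + s - 1)%C with ((y - 1) + s)%C by ring.
  unfold Rdiv at 1; rewrite (Rcpow_mult rho), !Rcpow_plus by assumption.
  rewrite <- (Rcpow_1 (/ (t * (1 - t)))) at 1 by exact Hi.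
  set (S := M_series _ _ _ _ _).
  assert (E : (Rcpow t s * Rcpow (1 - t) s * (Rcpow (/ (t * (1 - t))) 1 * Rcpow (/ (t * (1 - t))) (s - 1)))%C = 1%C).
  { rewrite <- Rcpow_mult, <- Rcpow_plus by lra.
    replace (1 + (s - 1))%C with s by ring; apply Rcpow_inv, Hw. }
  transitivity (Rcpow t (x - 1) * Rcpow (1 - t) (y - 1) * Rcpow rho (s - 1) * S *
    (Rcpow t s * Rcpow (1 - t) s * (Rcpow (/ (t * (1 - t))) 1 * Rcpow (/ (t * (1 - t))) (s - 1))))%C; [ring|].
  rewrite E; ring.
Qed.

(** [Hseries] and [HMgamma] make precise that the M-series and the M-gamma integral converge.
    Convergence of the M-beta integral for every rho > 0, and of its Mellin integral, is part of the
    conclusion. *)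
Theorem theorem3p1 (p q : nat) (kappa mu : list C) (alpha beta x y s : C)
  (Hp : length kappa = p) (Hq : length mu = q)
  (Hkappa : forall k : C, In k kappa -> ~ nonpos_integer k)
  (Hmu : forall k : C, In k mu -> ~ nonpos_integer k)
  (Halpha : 0 < Re alpha)
  (Hx : 0 < Re x) (Hy : 0 < Re y) (Hs : 0 < Re s)
  (Hxs : 0 < Re (x + s)%C) (Hys : 0 < Re (y + s)%C)
  (Hseries : forall t : R, 0 < t ->
     ex_Cseries (M_term kappa mu alpha beta (RtoC (- t))))
  (HMgamma : ex_CInt (M_gamma_integrand kappa mu alpha beta s (RtoC 0))
               (at_right 0) (Rbar_locally p_infty)) :
  (forall rho : R, 0 < rho ->
     ex_CInt (M_beta_integrand kappa mu alpha beta x y (RtoC rho))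
       (at_right 0) (at_left 1)) /\
  is_CInt
    (fun rho : R =>
       (Rcpow rho (s - RtoC 1) * M_beta kappa mu alpha beta x y (RtoC rho))%C)
    (at_right 0) (Rbar_locally p_infty)
    (Beta (x + s) (y + s) * M_gamma kappa mu alpha beta s (RtoC 0))%C.
Proof.
  set (h := fun u => (Rcpow u (s - 1) * M_series kappa mu alpha beta (RtoC (- u)))%C).
  assert (Hh : forall u, 0 < u -> continuous h u).
  { intros u Hu; apply continuous_Cmult; [apply continuous_Rcpow, Hu|apply continuous_M_series_neg; assumption]. }
  destruct HMgamma as [L HL].
  unfold M_gamma; rewrite (CInt_unique _ _ HL).
  assert (HL' : is_CInt h (at_right 0) (Rbar_locally p_infty) L).
  { revert HL; apply (is_RInt_gen_ext (V := C_R_NormedModule)), filter_forall; intros z t _.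
    as_C; unfold M_gamma_integrand, h.
    replace (- RtoC t - RtoC 0 / RtoC t)%C with (RtoC (- t)); [reflexivity|].
    unfold Cdiv; rewrite RtoC_opp, Cmult_0_l; ring. }
  destruct (primitive_of_improper h L Hh HL') as (H & HH & H0 & Hoo).
  assert (CH : forall u, 0 < u -> continuous H u).
  { intros u Hu; apply (ex_derive_continuous (V := C_R_NormedModule)); eexists; apply HH, Hu. }
  destruct (bounded_half_line H L CH H0 Hoo) as [M HM].
  (* The Beta integral converges, its integrand being dominated by itself. *)
  destruct (is_CInt_dominated (x + s) (y + s) (Beta_integrand (x + s) (y + s)) 1) as [B [HB _]]; auto; try lra.
  { intros t Ht; apply continuous_Beta_integrand, Ht. }
  { intros t Ht; lra. }
  unfold Beta; rewrite (CInt_unique _ _ HB).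
  assert (Nz : forall rho, 0 < rho -> (Rcpow rho (s - 1) * Rcpow (/ rho) (s - 1))%C = 1%C).
  { intros rho Hrho; apply Rcpow_inv, Hrho. }
  assert (HMb : forall rho, 0 < rho -> exists I,
    is_CInt (M_beta_integrand kappa mu alpha beta x y (RtoC rho)) (at_right 0) (at_left 1) I /\
    CInt (Mellin_kern (x + s) (y + s) h rho) (at_right 0) (at_left 1) = (Rcpow rho (s - 1) * I)%C).
  { intros rho Hrho.
    destruct (is_CInt_kern (x + s) (y + s) h H M rho) as [I [HI _]]; auto.
    (* The kernel integral carries the factor rho^(s-1); multiplying by the inverse (1/rho)^(s-1)
       recovers the M-beta integral and its convergence. *)
    exists (Rcpow (/ rho) (s - 1) * I)%C; split.
    2: { rewrite (CInt_unique _ _ HI), Cmult_assoc, Nz, Cmult_1_l by exact Hrho; reflexivity. }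
    apply (is_CInt_Cmult_l (Rcpow (/ rho) (s - 1))) in HI; revert HI.
    apply (is_RInt_gen_ext (V := C_R_NormedModule)).
    apply Filter_prod with (fun c => 0 < c < 1) (fun d => 0 < d < 1);
      [apply at_right_interval; lra|apply at_left_interval; lra|].
    intros c d Hc Hd t Ht; simpl in Ht; as_C.
    assert (Ht' : 0 < t < 1) by (revert Ht; apply Rmin_case; apply Rmax_case; lra).
    unfold h; rewrite kern_M_beta_integrand, Cmult_assoc, (Cmult_comm (Rcpow (/ rho) _)), Nz, Cmult_1_l by assumption.
    reflexivity. }
  split.
  - intros rho Hrho; destruct (HMb rho Hrho) as [I [HI _]]; exists I; exact HI.
  - generalize (is_CInt_Mellin (x + s) (y + s) h H M L B Hxs Hys Hh HH HM H0 Hoo HB).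
    apply (is_RInt_gen_ext (V := C_R_NormedModule)).
    apply Filter_prod with (fun a => 0 < a < 1) (fun b => 0 < b);
      [apply at_right_interval; lra|exists 0; trivial|].
    intros a b Ha Hb rho Hr; simpl in Hr; as_C.
    assert (Hrho : 0 < rho) by (revert Hr; apply Rmin_case; lra).
    destruct (HMb rho Hrho) as [I [HI EI]].
    unfold M_beta; rewrite (CInt_unique _ _ HI); exact EI.
Qed.
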